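(* Let $d:\mathfrak W_\Phi\to V^*$ be a semistable complementary polyhedron of the root system $\Phi$ in the Euclidean space $(V,\langle\cdot,\cdot\rangle)$. A facet $P$ of $\Phi$ is a Jordan-Hölder facet of $d$ if and only if $P$ is minimal, with respect to the order $\geq$ on facets, among the facets satisfying $$\text{(J1)}\qquad n(P,\lambda)=0\ \text{ for all } \lambda\in\mathrm{vert}(P).$$ In particular, a Jordan-Hölder facet of $d$ exists.
   Context: Let $(V,\langle\cdot,\cdot\rangle)$ be a finite-dimensional real inner product space and $\Phi\subset V$ a root system (finite, reduced, crystallographic, spanning $V$) with reflections $s_\alpha$. Weyl chambers are the connected components of $V\setminus\bigcup_{\alpha\in\Phi}\alpha^\perp$, and $\mathfrak W_\Phi$ is the set of Weyl chambers. Facets: $v,w\in V$ lie in the same facet iff for every $\alpha\in\Phi$ the numbers $\langle\alpha,v\rangle,\langle\alpha,w\rangle$ are both zero, both positive or both negative. Weyl chambers and $\{0\}$ are facets. For facets, $P\geq Q$ means $P\subset\mathrm{cl}(Q)$ (closure in $V$). A fundamental dominant weight is $\lambda\in V$ for which there are a set of simple roots $\triangle\subset\Phi$ and $\alpha\in\triangle$ with $\langle\alpha,\lambda\rangle=1$ and $\langle\beta,\lambda\rangle=0$ for all $\beta\in\triangle\setminus\{\alpha\}$. For a facet $P$, $\mathrm{vert}(P)$ is the set of fundamental dominant weights lying in $\mathrm{cl}(P)$. A map $d:\mathfrak W_\Phi\to V^*$ is a complementary polyhedron if: (A1) $d(\mathfrak c)(\lambda)=d(\mathfrak d)(\lambda)$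 for all chambers $\mathfrak c,\mathfrak d$ and all $\lambda\in\mathrm{vert}(\mathfrak c)\cap\mathrm{vert}(\mathfrak d)$; (A2) $d(\mathfrak c)(\alpha)\leq d(\mathfrak d)(\alpha)$ whenever $\alpha\in\Phi$ and $\mathfrak c$ is $\alpha$-conjugate to $\mathfrak d$, i.e. $\mathfrak c$ is positive with respect to $\alpha$, $\mathfrak d$ is negative with respect to $\alpha$, and $\mathfrak d=s_\alpha(\mathfrak c)$. Levi-factor: identify $V\cong V^*$ by $v\mapsto\langle v,\cdot\rangle$. For a facet $P$, let $\mathrm{pr}_P:V\to P^\perp$ be the orthogonal projection, and $\check P,\check P^\perp\subset V^*$ the images of $P,P^\perp$, with corresponding projection $\check{\mathrm{pr}}_P:V^*\to\check P^\perp\cong(P^\perp)^*$. Then $\Phi_P=\Phi\cap P^\perp$ is a root system of $P^\perp$, its chambers are the $\mathrm{pr}_P(\mathfrak c)$ for chambers $\mathfrak c$ of $\Phi$ with $P\geq\mathfrak c$ (bijectively), and the Levi-factor $d_P:\mathfrak W_{\Phi_P}\to\check P^\perp$, $d_P(\mathrm{pr}_P(\mathfrak c))=\check{\mathrm{pr}}_P(d(\mathfrak c))$, is a complementary polyhedron of $\Phi_P$. Stability: for a facet $P$ let $R(P)=\{\alpha\in\Phi\mid\langle\alpha,\lambda\rangle\geq0\ \forall\lambda\in\mathrm{vert}(P)\}$ and $\deg(P)=\sum_{\alpha\in R(P)}d(\mathfrak c)(\alpha)$ for any chamber $\mathfrak c$ with $P\geq\mathfrak c$ (independent of $\mathfrak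 c$). $d$ is semistable (resp. stable) if $\deg(P)\leq0$ (resp. $\deg(P)<0$) for all facets $P\neq\{0\}$. Numerical invariants: for $\lambda\in\mathrm{vert}(P)$, let $\Psi(P,\lambda)=\{\alpha\in\Phi\mid\langle\alpha,\lambda\rangle=1,\ \langle\alpha,\mu\rangle=0\ \forall\mu\in\mathrm{vert}(P)\setminus\{\lambda\}\}$ and $n(P,\lambda)=\sum_{\alpha\in\Psi(P,\lambda)}d(\mathfrak c)(\alpha)$ for any chamber $\mathfrak c$ with $P\geq\mathfrak c$ (independent of $\mathfrak c$). Jordan-Hölder facet: for $d$ semistable, a facet $P$ is a Jordan-Hölder facet if (J1) $n(P,\lambda)=0$ for all $\lambda\in\mathrm{vert}(P)$ and (J2) $d_P$ is a stable complementary polyhedron of $\Phi_P$. *)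

(* Defs.v *)
From HB Require Import structures.
From mathcomp Require Import all_boot all_order all_algebra finmap.
From mathcomp Require Import sesquilinear lra.
From mathcomp Require Import all_classical all_reals.
From mathcomp Require Import topology normedtype.

Set Implicit Arguments.
Unset Strict Implicit.
Unset Printing Implicit Defensive.

Import Order.TTheory GRing.Theory Num.Theory.
Import numFieldNormedType.Exports.

Local Open Scope classical_set_scope.
Local Open Scope ring_scope.

(* A finite-dimensional real inner product space is a [vectType] [V] with a
   positive definite symmetric form [ip]. The alias [euclid ip] of [V] carries
   the topology of the norm induced by [ip]. *)
Definition euclid (R : realType) (V : vectType R) (ip : {dot V for idfun})
  : Type := V.

Section EuclideanNorm.
Context (R : realType) (V : vectType R) (ip : {dot V for idfun}).

Definition ipnorm (x : V) : R := Num.sqrt (ip x x).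

Lemma ip_sym x y : ip x y = ip y x.
Proof. by rewrite hermC expr0 mul1r. Qed.

Lemma ip_ge0 x : 0 <= ip x x.
Proof.
have [->|x0] := eqVneq x 0; first by rewrite linear0l.
exact/ltW/neq0_dnorm_gt0.
Qed.

Lemma ip_cauchy_schwarz x y : ip x y ^+ 2 <= ip x x * ip y y.
Proof.
have [->|y0] := eqVneq y 0; first by rewrite !linear0r mulr0 expr0n.
have yy : 0 < ip y y by exact: neq0_dnorm_gt0.
have := ip_ge0 (ip y y *: x - ip x y *: y).
rewrite !linearBl !linearBr /= !linearZl_LR !linearZr_LR /= (ip_sym y x).
set a := ip x x; set b := ip x y; set c := ip y y => h.
have : 0 <= c * (a * c - b ^+ 2) by lra.
by rewrite pmulr_rge0// subr_ge0.
Qed.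

Lemma ipnormD x y : ipnorm (x + y) <= ipnorm x + ipnorm y.
Proof.
rewrite -(@ler_pXn2r _ 2) ?nnegrE ?addr_ge0 ?sqrtr_ge0//.
rewrite sqrrD !sqr_sqrtr ?ip_ge0// linearDl !linearDr /= (ip_sym y x).
have : ip x y <= ipnorm x * ipnorm y.
  rewrite -sqrtrM ?ip_ge0// (le_trans (ler_norm _))// -sqrtr_sqr.
  by rewrite ler_wsqrtr// ip_cauchy_schwarz.
by rewrite /ipnorm; lra.
Qed.

Lemma ipnormZ (l : R) x : ipnorm (l *: x) = `|l| * ipnorm x.
Proof.
by rewrite /ipnorm linearZl_LR linearZr_LR /= mulrA -expr2 sqrtrM ?sqr_ge0//
  sqrtr_sqr.
Qed.

Lemma ipnorm_eq0 x : ipnorm x = 0 -> x = 0.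
Proof.
have [//|x0 /eqP] := eqVneq x 0.
by rewrite sqrtr_eq0 leNgt neq0_dnorm_gt0.
Qed.
End EuclideanNorm.

HB.instance Definition _ (R : realType) (V : vectType R)
  (ip : {dot V for idfun}) := Vector.copy (euclid ip) V.
HB.instance Definition _ (R : realType) (V : vectType R)
    (ip : {dot V for idfun}) :=
  @Lmodule_isNormed.Build R (euclid ip) (ipnorm ip)
    (ipnormD ip) (ipnormZ ip) (@ipnorm_eq0 _ _ ip).

Section RootSystems.
Context (R : realType) (V : vectType R) (ip : {dot V for idfun}).
Implicit Types (U P Q c e : set V) (Phi Delta : {fset V}) (a b l m v w : V).

Definition cl (A : set V) : set V := @closure (euclid ip) A.

Definition perp (A : set V) : set V := [set v | forall x, A x -> ip x v = 0].

Definition reflection a v : V := v - (2 * ip a v / ip a a) *: a.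

(* Root systems live in a subspace [U] of a fixed space [V], so that the root
   systems [Phi_P] of the subspaces [P^perp] are covered by the same
   definitions; [U] is an explicit parameter throughout. *)
Definition root_system U Phi : Prop :=
  [/\ U = [set v | v \in <<Phi>>%VS],
      0 \notin Phi,
      {in Phi &, forall a b, reflection a b \in Phi},
      {in Phi &, forall a b, 2 * ip a b / ip a a \is a Num.int} &
      {in Phi, forall a (t : R), t *: a \in Phi -> t = 1 \/ t = -1}].

Definition weyl_chamber U Phi c : Prop :=
  let A := U `\` \bigcup_(a in [set` Phi]) perp [set a] in
  exists2 v, A v & c = @connected_component (euclid ip) A v.

Definition same_facet Phi v w : Prop :=
  forall a, a \in Phi ->
    [\/ ip a v = 0 /\ ip a w = 0,
        0 < ip a v /\ 0 < ip a w |
        ip a v < 0 /\ ip a w < 0].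

Definition facet U Phi P : Prop :=
  exists2 v, U v & P = [set w | U w /\ same_facet Phi v w].

Definition facet_ge P Q : Prop := P `<=` cl Q.

Definition simple_roots U Phi Delta : Prop :=
  [/\ {subset Delta <= Phi},
      free Delta,
      U = [set v | v \in <<Delta>>%VS] &
      forall a, a \in Phi -> exists k : V -> nat,
        a = \sum_(b <- Delta) b *+ k b \/ a = - \sum_(b <- Delta) b *+ k b].

Definition fundamental_dominant_weight U Phi l : Prop :=
  U l /\ exists2 Delta : {fset V}, simple_roots U Phi Delta &
    exists2 a, a \in Delta &
      ip a l = 1 /\ forall b, b \in Delta -> b != a -> ip b l = 0.

Definition vert U Phi P : set V :=
  [set l | fundamental_dominant_weight U Phi l /\ cl P l].

(* The dual of [V] is ['Hom(V, R^o)]; the dual of a subspace [U] is the image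
   of [U] under the isomorphism [flat]. *)
Definition flat v : 'Hom(V, R^o) := linfun (ip v : V -> R^o).

Definition sharp (f : 'Hom(V, R^o)) : V := xget 0 [set v | flat v = f].

Definition dual_space U : set 'Hom(V, R^o) := flat @` U.

Definition positive_wrt a c : Prop := forall x, c x -> 0 < ip a x.
Definition negative_wrt a c : Prop := forall x, c x -> ip a x < 0.

Definition conjugate_wrt a c e : Prop :=
  [/\ positive_wrt a c, negative_wrt a e & e = reflection a @` c].

(* Maps defined on the set of Weyl chambers are represented by total functions
   on [set V] whose values at other sets are irrelevant. *)
Implicit Type d : set V -> 'Hom(V, R^o).

Definition complementary_polyhedron U Phi d : Prop :=
  [/\ forall c, weyl_chamber U Phi c -> dual_space U (d c),
      forall c e l, weyl_chamber U Phi c -> weyl_chamber U Phi e ->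
        (vert U Phi c `&` vert U Phi e) l -> d c l = d e l &
      forall c e a, weyl_chamber U Phi c -> weyl_chamber U Phi e ->
        a \in Phi -> conjugate_wrt a c e -> d c a <= d e a].

(* A choice of Weyl chamber [c] with [P >= c]; for a complementary polyhedron,
   [deg] and [n_inv] below do not depend on it. *)
Definition chamber_of U Phi P : set V :=
  xget set0 [set c | weyl_chamber U Phi c /\ facet_ge P c].

Definition R_roots U Phi P : set V :=
  [set a | a \in Phi /\ forall l, vert U Phi P l -> 0 <= ip a l].

Definition deg U Phi d P : R :=
  \sum_(a <- Phi | a \in R_roots U Phi P) d (chamber_of U Phi P) a.

Definition semistable U Phi d : Prop :=
  forall P, facet U Phi P -> P <> [set 0] -> deg U Phi d P <= 0.

Definition stable U Phi d : Prop :=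
  forall P, facet U Phi P -> P <> [set 0] -> deg U Phi d P < 0.

Definition Psi_roots U Phi P l : set V :=
  [set a | [/\ a \in Phi, ip a l = 1 &
    forall m, vert U Phi P m -> m <> l -> ip a m = 0]].

Definition n_inv U Phi d P l : R :=
  \sum_(a <- Phi | a \in Psi_roots U Phi P l) d (chamber_of U Phi P) a.

Definition orth_proj U v : V :=
  xget 0 [set w | U w /\ forall z, U z -> ip z (v - w) = 0].

Definition dual_proj U (f : 'Hom(V, R^o)) : 'Hom(V, R^o) :=
  flat (orth_proj U (sharp f)).

Definition levi_space U P : set V := U `&` perp P.

Definition levi_roots U Phi P : {fset V} :=
  [fset a in Phi | a \in levi_space U P]%fset.

(* The inner [xget] is the inverse of the bijection [c |-> pr_P(c)] from the
   Weyl chambers [c] with [P >= c] to the Weyl chambers of [Phi_P]. *)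
Definition levi_factor U Phi d P : set V -> 'Hom(V, R^o) :=
  fun e => dual_proj (levi_space U P)
    (d (xget set0 [set c | [/\ weyl_chamber U Phi c, facet_ge P c &
                               orth_proj (levi_space U P) @` c = e]])).

Definition J1 U Phi d P : Prop :=
  forall l, vert U Phi P l -> n_inv U Phi d P l = 0.

Definition J2 U Phi d P : Prop :=
  let W := levi_space U P in
  let PhiP := levi_roots U Phi P in
  let dP := levi_factor U Phi d P in
  complementary_polyhedron W PhiP dP /\ stable W PhiP dP.

Definition jordan_holder_facet U Phi d P : Prop :=
  [/\ facet U Phi P, J1 U Phi d P & J2 U Phi d P].

Definition minimal_J1_facet U Phi d P : Prop :=
  [/\ facet U Phi P, J1 U Phi d P &
      forall Q, facet U Phi Q -> J1 U Phi d Q -> facet_ge P Q -> Q = P].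

End RootSystems.

(* Main.v *)
Require Import Defs.
From HB Require Import structures.
From mathcomp Require Import all_boot all_order all_algebra finmap.
From mathcomp Require Import sesquilinear lra.
From mathcomp Require Import all_classical all_reals.
From mathcomp Require Import topology normedtype.

Set Implicit Arguments.
Unset Strict Implicit.
Unset Printing Implicit Defensive.

Import Order.TTheory GRing.Theory Num.Theory.
Import numFieldNormedType.Exports.

Local Open Scope classical_set_scope.
Local Open Scope ring_scope.

(** For a facet [P] write [face p], where [p] is an interior point, and say
    that [p] specializes to [x] when [x] lies in the closure of [face p]; for
    points of the root space this is a condition on the signs of the roots.

    The first observation is that a complementary polyhedron [d] is the same as
    a function [D] on the root space, linear on each closed chamber: condition
    (A1) says exactly that [d c] and [d e] agree on the common points of the
    closures of [c] and [e], because the fundamental weights occurring in such a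
    point lie in both closures ([specializes_weight], [polyhedron_agree]). The
    other notions are then statements about [D].

    - The degree of [face p] is the value of [D] at the sum [w p] of the roots
      that are nonnegative at [p], and [w p] again lies in [face p]
      ([nonneg_root_sum_face], [deg_nonneg_root_sum]). On the ray of a
      fundamental weight, [w] is a positive multiple of this weight, so [d] is
      semistable only if [D <= 0] at the fundamental weights, hence everywhere
      ([semistable_le0]).
    - For semistable [d], the facet [face p] satisfies (J1) if and only if
      [D p = 0] ([J1P]). The vectors whose values under [D] are the invariants
      [n(P, lambda)] form a basis of the span of the facet, so (J1) says that
      [D] vanishes on the facet; as [D] has one sign, vanishing at one interior
      point suffices.
    - The Levi factor at [face p] is the first-order expansion of [D] at [p]:
      the chamber of [v] in the Levi root system corresponds to the chamber of
      [p + t *: v] for small [t > 0] ([levi_factor_lift]), and (A1) and (A2)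
      are inherited through this description ([levi_factor_polyhedron]). If
      [D p = 0], the degree of the facet of [q] in the Levi root system is, up
      to a positive factor, the value of [D] at a point of the facet of
      [p + t *: q] ([levi_deg]).

    The facets whose closure contains [face p] are the facets of the points
    [p + t *: q] with [q] orthogonal to [face p] and [t] small, and those
    different from [face p] come from [q != 0]. Under (J1) the degrees of the
    Levi factor are therefore nonpositive, and the one at [q] vanishes exactly
    when the facet of [p + t *: q] satisfies (J1). So the Levi factor is stable
    if and only if no facet strictly below [face p] satisfies (J1). Since
    [D 0 = 0], some facet satisfies (J1), and among these facets one off as many
    root hyperplanes as possible is minimal. *)

(** * Inner products *)

Section InnerProduct.
Context (R : realType) (V : vectType R) (ip : {dot V for idfun}).
Implicit Types (a b u v w x y z : V) (r t : R) (X : seq V).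

Lemma ipDr x y z : ip x (y + z) = ip x y + ip x z.
Proof. by rewrite linearDr. Qed.

Lemma ipZr r x y : ip x (r *: y) = r * ip x y.
Proof. by rewrite linearZr_LR. Qed.

Lemma ipNr x y : ip x (- y) = - ip x y.
Proof. by rewrite linearNr. Qed.

Lemma ipBr x y z : ip x (y - z) = ip x y - ip x z.
Proof. by rewrite ipDr ipNr. Qed.

Lemma ip0r x : ip x 0 = 0.
Proof. by rewrite linear0r. Qed.

Lemma ipDl x y z : ip (x + y) z = ip x z + ip y z.
Proof. by rewrite linearDl. Qed.

Lemma ipZl r x y : ip (r *: x) y = r * ip x y.
Proof. by rewrite linearZl_LR. Qed.

Lemma ipNl x y : ip (- x) y = - ip x y.
Proof. by rewrite linearNl. Qed.

Lemma ipBl x y z : ip (x - y) z = ip x z - ip y z.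
Proof. by rewrite ipDl ipNl. Qed.

Lemma ip0l x : ip 0 x = 0.
Proof. by rewrite linear0l. Qed.

Lemma ip_sumr (I : Type) (s : seq I) (P : pred I) (f : I -> V) x :
  ip x (\sum_(i <- s | P i) f i) = \sum_(i <- s | P i) ip x (f i).
Proof.
apply: (big_morph (ip x) (id1 := 0) (op1 := +%R)); first exact: ipDr.
exact: ip0r.
Qed.

Lemma ip_suml (I : Type) (s : seq I) (P : pred I) (f : I -> V) x :
  ip (\sum_(i <- s | P i) f i) x = \sum_(i <- s | P i) ip (f i) x.
Proof. by rewrite ip_sym ip_sumr; apply: eq_bigr => i _; rewrite ip_sym. Qed.

Lemma ip_eq0 x : ip x x = 0 -> x = 0.
Proof. by move=> h; apply: (@ipnorm_eq0 _ _ ip); rewrite /ipnorm h sqrtr0. Qed.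

Lemma ip_gt0 x : x != 0 -> 0 < ip x x.
Proof. exact: neq0_dnorm_gt0. Qed.

Lemma ip_span_eq0 X x :
  (forall y, y \in X -> ip y x = 0) -> forall z, z \in <<X>>%VS -> ip z x = 0.
Proof.
move=> h z /(@coord_span _ _ _ (in_tuple X)) ->.
rewrite ip_suml big1// => i _; rewrite ipZl h ?mulr0//.
by rewrite mem_nth.
Qed.

(** Gram-Schmidt: one new spanning vector only contributes along its component
    orthogonal to the previous ones. *)
Lemma orthogonal_projection_exists X v :
  exists2 w, w \in <<X>>%VS & forall z, z \in <<X>>%VS -> ip z (v - w) = 0.
Proof.
elim: X v => [|x X IH] v.
  exists 0; first by rewrite mem0v.
  by move=> z; rewrite span_nil memv0 => /eqP ->; rewrite ip0l.
have [w wX hw] := IH v; have [y yX hy] := IH x.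
pose e := x - y; pose t := ip e v / ip e e.
have sX : (<<X>> <= <<x :: X>>)%VS by rewrite span_cons addvSr.
have ex : e \in <<x :: X>>%VS.
  by rewrite memvB// ?(subvP sX _ yX)// memv_span// mem_head.
exists (w + t *: e).
  by rewrite memvD// ?(subvP sX _ wX)// memvZ.
apply: ip_span_eq0 => z; rewrite inE => /orP[/eqP->|zX]; last first.
  have {}zX := memv_span zX.
  by rewrite opprD addrA ipBr hw// ipZr hy// mulr0 subr0.
have eX u : u \in <<X>>%VS -> ip e u = 0 by move=> /hy; rewrite ip_sym.
rewrite -[x](subrK y) -/e opprD addrA ipDl [ip y _]ipBr hw// ipZr hy//.
rewrite mulr0 subr0 addr0 !ipBr (eX w)// subr0 ipZr /t.
have [->|e0] := eqVneq e 0; first by rewrite !ip0l mulr0 subr0.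
by rewrite divfK ?subrr// gt_eqF// ip_gt0.
Qed.

(** Vectors that make pairwise non-acute angles and lie strictly on one side
    of a hyperplane are independent: the positive and the negative half of a
    relation between them are equal, so the scalar product of the halves is at
    once a square and a sum of nonpositive terms. *)
Lemma free_obtuse X v : uniq X -> {in X, forall a, 0 < ip a v} ->
  {in X &, forall a b, a != b -> ip a b <= 0} -> free X.
Proof.
move=> uX pX oX; rewrite -[X]/(tval (in_tuple X)); apply/freeP => k k0 i.
pose e := \sum_(i < size X) Num.max (k i) 0 *: X`_i.
pose f := \sum_(i < size X) Num.max (- k i) 0 *: X`_i.
have ef : e = f.
  apply/eqP; rewrite -subr_eq0 -sumrB -[X in _ == X]k0; apply/eqP.
  apply: eq_bigr => j _; rewrite -scalerBl; congr (_ *: _).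
  by rewrite /Num.max; case: ltP => ?; case: ltP => ?; lra.
have e0 : e = 0.
  apply: ip_eq0; apply/eqP; rewrite eq_le ip_ge0 andbT {2}ef ip_suml.
  apply: sumr_le0 => j _; rewrite ipZl ip_sumr mulr_sumr.
  apply: sumr_le0 => l _; rewrite ipZr mulrA.
  have [<-|jl] := eqVneq j l.
    have -> : Num.max (k j) 0 * Num.max (- k j) 0 = 0; last by rewrite mul0r.
    rewrite /Num.max; case: ltP => ?; case: ltP => ?; rewrite ?mul0r ?mulr0//.
    have kj0 : k j = 0 by lra.
    by rewrite kj0 mul0r.
  apply: mulr_ge0_le0; first by rewrite mulr_ge0// le_max lexx orbT.
  by apply: oX; rewrite ?mem_nth// nth_uniq.
have half (g : 'I_(size X) -> R) : (forall j, 0 <= g j) ->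
    \sum_(i < size X) g i *: X`_i = 0 -> g i = 0.
  move=> g0 /(congr1 (ip^~ v)); rewrite ip0l ip_suml => /eqP.
  have Xv (j : 'I_(size X)) : 0 < ip X`_j v by rewrite pX// mem_nth.
  rewrite psumr_eq0 => [/allP/(_ i)|j _]; last by rewrite ipZl mulr_ge0// ltW.
  rewrite mem_index_enum ipZl mulf_eq0 => /(_ isT) /orP[/eqP//|].
  by rewrite gt_eqF.
have := half (fun i => Num.max (k i) 0) _ e0.
have := half (fun i => Num.max (- k i) 0) _ (etrans (esym ef) e0).
rewrite /Num.max => h1 h2.
have /h1 : forall j, 0 <= (if - k j < 0 then 0 else - k j).
  by move=> j; case: ltP.
have /h2 : forall j, 0 <= (if k j < 0 then 0 else k j).
  by move=> j; case: ltP.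
by case: ltP => ?; case: ltP => ?; lra.
Qed.

End InnerProduct.

(** * Facets as sign conditions *)

Section Facets.
Context (R : realType) (V : vectType R) (ip : {dot V for idfun}).
Implicit Types (a b p q u v w x y z : V) (r s t : R) (U : set V)
  (Phi : {fset V}).

Definition subspace U := U 0 /\ forall r x y, U x -> U y -> U (r *: x + y).

Definition face U Phi p : set V := [set w | U w /\ same_facet ip Phi p w].

(** For [p] and [x] in the root space this says that [x] lies in the closure of
    the facet of [p] ([cl_face]). As the roots come in opposite pairs, it covers
    the zero and the negative signs at [p] as well. *)
Definition specializes Phi p x :=
  forall a, a \in Phi -> 0 <= ip a p -> 0 <= ip a x.

Definition regular Phi v := forall a, a \in Phi -> ip a v != 0.

Definition sign_symmetric Phi := forall a, a \in Phi -> - a \in Phi.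

Lemma subspaceD U x y : subspace U -> U x -> U y -> U (x + y).
Proof. by move=> [_ h] Ux Uy; rewrite -[x]scale1r; apply: h. Qed.

Lemma subspaceZ U r x : subspace U -> U x -> U (r *: x).
Proof. by move=> [h0 h] Ux; rewrite -[_ *: _]addr0; apply: h. Qed.

Lemma subspaceB U x y : subspace U -> U x -> U y -> U (x - y).
Proof. by move=> hU Ux Uy; rewrite -scaleN1r addrC; apply: hU.2. Qed.

Lemma subspace_sum (I : eqType) (s : seq I) (P : pred I) (f : I -> V) U :
  subspace U -> (forall i, i \in s -> P i -> U (f i)) ->
  U (\sum_(i <- s | P i) f i).
Proof.
move=> hU hf; rewrite big_seq_cond.
apply: (big_ind U) => [|x y|i /andP[]]; [exact: hU.1|exact: subspaceD|].
exact: hf.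
Qed.

Lemma same_facetP Phi v w : same_facet ip Phi v w <->
  forall a, a \in Phi -> Num.sg (ip a v) = Num.sg (ip a w).
Proof.
split=> h a /h => [[[-> ->]//|[v0 w0]|[v0 w0]]|].
- by rewrite !gtr0_sg.
- by rewrite !ltr0_sg.
case: (ltrgt0P (ip a v)) => hv.
- rewrite gtr0_sg// => /esym/eqP; rewrite sgr_cp0 => hw.
  by apply: Or32.
- rewrite ltr0_sg// => /esym/eqP; rewrite sgr_cp0 => hw.
  by apply: Or33.
- rewrite hv sgr0 => /esym/eqP; rewrite sgr_cp0 => /eqP hw.
  by apply: Or31.
Qed.

Lemma same_facet_refl Phi v : same_facet ip Phi v v.
Proof. exact/same_facetP. Qed.

Lemma face_refl U Phi p : U p -> face U Phi p p.
Proof. by move=> Up; split=> //; exact: same_facet_refl. Qed.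

Lemma specializes_trans Phi p q x :
  specializes Phi p q -> specializes Phi q x -> specializes Phi p x.
Proof. by move=> pq qx a aP /pq-/(_ aP)/qx; apply. Qed.

Lemma specializes_eq0 Phi p x a : sign_symmetric Phi -> specializes Phi p x ->
  a \in Phi -> ip a p = 0 -> ip a x = 0.
Proof.
move=> hs px aP ap0; apply/eqP; rewrite eq_le px ?ap0// andbT.
by have := px _ (hs _ aP); rewrite !ipNl ap0 oppr0 lexx oppr_ge0 => ->.
Qed.

Lemma same_facet_specializes Phi v w :
  same_facet ip Phi v w -> specializes Phi v w.
Proof. by move=> /same_facetP h a aP; rewrite -sgr_ge0 h// sgr_ge0. Qed.

Lemma same_facetC Phi v w : same_facet ip Phi v w -> same_facet ip Phi w v.
Proof. by move=> /same_facetP h; apply/same_facetP => a /h. Qed.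

Lemma same_facet_specializesP Phi v w : sign_symmetric Phi ->
  specializes Phi v w -> specializes Phi w v -> same_facet ip Phi v w.
Proof.
move=> hs vw wv; apply/same_facetP => a aP.
case: (ltrgt0P (ip a w)) => hw.
- rewrite (gtr0_sg hw); apply/gtr0_sg; rewrite lt_def (wv _ aP) ?ltW// andbT.
  apply/eqP => /(specializes_eq0 hs vw aP) w0.
  by rewrite w0 ltxx in hw.
- rewrite (ltr0_sg hw); apply/ltr0_sg; rewrite ltNge; apply/negP => /(vw _ aP).
  by rewrite leNgt hw.
- by rewrite hw (specializes_eq0 hs wv aP hw).
Qed.

Lemma specializes_lt Phi p x a : sign_symmetric Phi -> specializes Phi p x ->
  a \in Phi -> 0 < ip a x -> 0 < ip a p.
Proof.
move=> hs px aP h; rewrite ltNge; apply/negP => ap.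
have := px _ (hs _ aP); rewrite !ipNl !oppr_ge0 => /(_ ap).
by rewrite leNgt h.
Qed.

Lemma face_eq U Phi v w : same_facet ip Phi v w -> face U Phi v = face U Phi w.
Proof.
move=> /same_facetP vw; apply/seteqP; split=> x /= [Ux /same_facetP h];
  split=> //; apply/same_facetP => a aP.
  by rewrite -vw// h.
by rewrite vw// h.
Qed.

(** A small displacement leaves the nonzero signs alone, so the signs at
    [p + t *: y] are lexicographic: first those of [p], then those of [y]. *)
Lemma small_displacement Phi p y : exists2 t, 0 < t & forall a, a \in Phi ->
  Num.sg (ip a (p + t *: y)) =
  if ip a p == 0 then Num.sg (ip a y) else Num.sg (ip a p).
Proof.
suff [t t0 ht] : exists2 t, 0 < t & forall r, 0 < r <= t ->
    forall a, a \in (Phi : seq V) -> ip a p != 0 ->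
    Num.sg (ip a (p + r *: y)) = Num.sg (ip a p).
  exists t => // a aP; case: eqP => [ap|/eqP ap]; last by rewrite ht ?t0 ?lexx.
  by rewrite ipDr ap add0r ipZr sgrM gtr0_sg// mul1r.
elim: (Phi : seq V) => [|b s [t t0 ht]]; first by exists 1.
have [b0|b0] := eqVneq (ip b p) 0.
  exists t => // r hr a; rewrite inE => /orP[/eqP->|]; last exact: ht.
  by rewrite b0 eqxx.
pose e := `|ip b p| / (`|ip b y| + 1).
have d0 : 0 < `|ip b y| + 1 by rewrite ltr_wpDl.
have e0 : 0 < e by rewrite divr_gt0// normr_gt0.
exists (Num.min t e) => [|r]; first by rewrite lt_min t0.
rewrite le_min => /and3P[r0 rt re] a; rewrite inE => /orP[/eqP->|]; last first.
  by apply: ht; rewrite r0.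
move=> _; rewrite ipDr ipZr.
have : r * `|ip b y| < `|ip b p|.
  apply: (@lt_le_trans _ _ (r * (`|ip b y| + 1))); last first.
    by rewrite -ler_pdivlMr.
  by rewrite ltr_pM2l// ltrDl.
rewrite -{1}(gtr0_norm r0) -normrM ltr_norml => /andP[].
case: (ltrgt0P (ip b p)) => [hb l1 l2|hb l1 l2|bp0 l1 l2].
- by rewrite !gtr0_sg//; lra.
- by rewrite !ltr0_sg//; lra.
- by rewrite bp0 eqxx in b0.
Qed.

(** * Chambers and closures in the topology of the inner product *)

Lemma ip_continuous a : continuous (fun x : euclid ip => ip a (x : V) : R).
Proof.
move=> x; apply/(@cvgrPdist_lt _ _ _ _ (nbhs_filter x)) => e e0.
have n0 : 0 < ipnorm ip a + 1 by rewrite ltr_wpDl// sqrtr_ge0.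
apply/nbhs_ballP; exists (e / (ipnorm ip a + 1)) => /=; first exact: divr_gt0.
move=> y; rewrite -ball_normE /= ltr_pdivlMr// mulrC => xy.
rewrite -ipBr -sqrtr_sqr; apply: le_lt_trans xy.
apply: (@le_trans _ _ (Num.sqrt (ip a a * ip (x - y : V) (x - y : V)))).
  by rewrite ler_wsqrtr// ip_cauchy_schwarz.
by rewrite sqrtrM ?ip_ge0// ler_wpM2r ?sqrtr_ge0// lerDl.
Qed.

Lemma line_continuous v w : continuous (fun t : R => (v + t *: w : euclid ip)).
Proof.
move=> t; apply: (@cvgD _ (euclid ip)); first exact: cvg_cst.
by apply: cvgZr_tmp; exact: cvg_id.
Qed.

(** A weak inequality survives a limit; conversely the points [x + t *: p] with
    [t > 0] lie in the facet of [p] and tend to [x]. *)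
Lemma cl_face U Phi p x : subspace U -> sign_symmetric Phi -> U p -> U x ->
  cl ip (face U Phi p) x <-> specializes Phi p x.
Proof.
move=> hU hs Up Ux; split=> [clx a aP ap|px].
  rewrite leNgt; apply/negP => ax.
  have /clx[y [[_ /same_facet_specializes/(_ a aP ap)]]] :
      nbhs (x : euclid ip) [set y : euclid ip | ip a (y : V) < 0].
    by apply: (@ip_continuous a x [set r : R | r < 0]); exact: lt_nbhsl.
  by rewrite /= leNgt => /negbTE ->.
move=> B /= hB.
have l0 : (fun t : R => (x + t *: p : euclid ip)) @ (0 : R) --> (x : euclid ip).
  by have := @line_continuous x p 0; rewrite /continuous_at scale0r addr0.
have /= := l0 _ hB; rewrite -nearE => /nbhs_ballP[e /= e0 he].
exists (x + (e / 2) *: p); split; last first.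
  by apply: he; rewrite /ball /= sub0r normrN gtr0_norm ?divr_gt0//; lra.
split; first by apply: subspaceD => //; exact: subspaceZ.
apply/same_facetP => a aP; rewrite ipDr ipZr.
case: (ltrgt0P (ip a p)) => ap.
- have := px _ aP (ltW ap) => ax; rewrite !gtr0_sg// ltr_wpDl// mulr_gt0//.
  by rewrite divr_gt0.
- have := px _ (hs _ aP); rewrite !ipNl !oppr_ge0 => /(_ (ltW ap)) ax.
  rewrite !ltr0_sg// ltr_wnDl// nmulr_llt0//; by rewrite divr_gt0.
- by rewrite ap (specializes_eq0 hs px aP ap) mulr0 addr0.
Qed.

Lemma facet_ge_face U Phi p q : subspace U -> sign_symmetric Phi ->
  U p -> U q -> facet_ge ip (face U Phi p) (face U Phi q) <->
  specializes Phi q p.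
Proof.
move=> hU hs Up Uq; split=> [h|h x [Ux px]].
  by apply/(cl_face hU hs Uq Up); apply: h; exact: face_refl.
apply/(cl_face hU hs Uq Ux).
exact: specializes_trans h (same_facet_specializes px).
Qed.

(** Along a connected set that avoids the root hyperplanes no root changes sign,
    since its values form an interval without 0; conversely a set of prescribed
    signs contains the segment between any two of its points. *)
Lemma weyl_chamberP U Phi c : subspace U ->
  weyl_chamber ip U Phi c <->
  exists v, [/\ U v, regular Phi v & c = face U Phi v].
Proof.
move=> hU.
pose A := U `\` \bigcup_(a in [set` Phi]) perp ip [set a].
have AE v : A v <-> U v /\ regular Phi v.
  split=> [[Uv h]|[Uv h]]; split=> //.
    move=> a aP; apply/eqP => av; apply: h; exists a => //= x ->.
    exact: av.
  by move=> [a /= aP /(_ a erefl)/eqP]; rewrite (negbTE (h _ aP)).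
have comp v : A v -> @connected_component (euclid ip) A v = face U Phi v.
  move=> Av; have [Uv rv] := (AE v).1 Av; apply/seteqP; split=> w.
    move=> [C [Cv CA Cc] Cw]; have [Uw rw] := (AE w).1 (CA _ Cw).
    split=> //; apply/same_facetP => a aP.
    have : is_interval [set ip a (y : V) | y in C].
      apply/connected_intervalP.
      apply: (@connected_continuous_connected (euclid ip) R^o) => //.
      apply: continuous_subspaceT.
      exact: ip_continuous.
    have IC (y : V) : C y -> [set ip a (y : V) | y in C] (ip a y).
      by move=> Cy; exists y.
    have not0 : ~ [set ip a (y : V) | y in C] 0.
      by move=> [y /CA/AE[_ /(_ a aP)/eqP ry]] /ry.
    move=> iC; case: (ltrgt0P (ip a v)) => av.
    - rewrite gtr0_sg//; apply/esym/gtr0_sg; rewrite ltNge; apply/negP => aw.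
      by apply: not0; apply: (iC _ _ (IC _ Cw) (IC _ Cv)); rewrite aw ltW.
    - rewrite ltr0_sg//; apply/esym/ltr0_sg; rewrite ltNge; apply/negP => aw.
      by apply: not0; apply: (iC _ _ (IC _ Cv) (IC _ Cw)); rewrite aw ltW.
    - by have := rv _ aP; rewrite av eqxx.
  move=> [Uw /same_facetP vw].
  have seg : connected
      [set (v + t *: (w - v) : euclid ip) | t in `[0, 1]%classic].
    apply: connected_continuous_connected; last first.
      by apply: continuous_subspaceT; exact: line_continuous.
    by apply/connected_intervalP; exact: interval_is_interval.
  exists [set (v + t *: (w - v) : euclid ip) | t in `[0, 1]%classic].
    split=> //.
      by exists 0; rewrite ?scale0r ?addr0//= in_itv/= lexx ler01.
    move=> _ [t /= ht <-]; apply/AE; split.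
      by apply: subspaceD => //; apply: subspaceZ => //; exact: subspaceB.
    move=> a aP; move: ht; rewrite in_itv /= => /andP[t0 t1].
    have := rv _ aP; have := vw _ aP; rewrite ipDr ipZr ipBr.
    case: (ltrgt0P (ip a v)) => av.
    - rewrite gtr0_sg// => /esym/eqP; rewrite sgr_cp0 => aw _.
      by apply/lt0r_neq0; nra.
    - rewrite ltr0_sg// => /esym/eqP; rewrite sgr_cp0 => aw _.
      by apply/ltr0_neq0; nra.
    - by [].
  by exists 1; rewrite /= ?in_itv/= ?ler01 ?lexx// scale1r addrC subrK.
split=> [[v Av ->]|[v [Uv rv ->]]].
  by exists v; have [? ?] := (AE v).1 Av; split => //; exact: comp.
have Av : A v by apply/AE.
by exists v => //; rewrite comp.
Qed.

End Facets.

(** * Reflections and root systems *)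

Section Reflections.
Context (R : realType) (V : vectType R) (ip : {dot V for idfun}).
Implicit Types (a b x y : V) (r : R).

Lemma reflectionE a x : reflection ip a x = x - (2 * ip a x / ip a a) *: a.
Proof. by []. Qed.

Lemma ip_reflection a x y :
  ip (reflection ip a x) y = ip x (reflection ip a y).
Proof.
rewrite !reflectionE ipBl ipBr ipZl ipZr (ip_sym _ x a); congr (_ - _).
by rewrite mulrAC [RHS]mulrAC -!mulrA (mulrCA (ip a x)).
Qed.

Lemma reflection_root a : a != 0 -> reflection ip a a = - a.
Proof.
move=> a0; rewrite reflectionE mulfK ?gt_eqF ?ip_gt0// scaler_nat mulr2n.
by rewrite opprD addNKr.
Qed.

Lemma ip_root_reflection a x : a != 0 -> ip a (reflection ip a x) = - ip a x.
Proof. by move=> a0; rewrite -ip_reflection reflection_root// ipNl. Qed.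

Lemma reflectionK a : a != 0 -> involutive (reflection ip a).
Proof.
move=> a0 x; rewrite {1}reflectionE ip_root_reflection// reflectionE.
by rewrite mulrN mulNr scaleNr opprK subrK.
Qed.

Lemma reflection_id a x : ip a x = 0 -> reflection ip a x = x.
Proof. by move=> h; rewrite reflectionE h mulr0 mul0r scale0r subr0. Qed.

End Reflections.

(** * Simple roots and fundamental weights of a chamber *)

(** The simple roots [D] of the chamber of [v], with the basis [lam] of [U]
    dual to them: [lam a] is the fundamental dominant weight belonging to
    [a]. *)
Record weight_basis (R : realType) (V : vectType R) (ip : {dot V for idfun})
    (U : set V) (Phi : {fset V}) (v : V) (D : {fset V}) (lam : V -> V) : Prop :=
  WeightBasis {
    wb_simple : simple_roots U Phi D;
    wb_pos : {in D, forall a, 0 < ip a v};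
    wb_mem : {in D, forall a, U (lam a)};
    wb_dual : {in D &, forall a b, ip b (lam a) = (b == a)%:R} }.

Section RootSystem.
Context (R : realType) (V : vectType R) (ip : {dot V for idfun}).
Context (U : set V) (Phi : {fset V}) (hPhi : root_system ip U Phi).
Implicit Types (a b l p q u v w x y z : V) (r s t : R) (D : {fset V}).

Lemma root_space_subspace : subspace U.
Proof.
have [-> _ _ _ _] := hPhi; split=> /= [|r x y]; first exact: mem0v.
by move=> hx hy; rewrite memvD// memvZ.
Qed.

Lemma root_mem a : a \in Phi -> U a.
Proof. by have [-> _ _ _ _] := hPhi; exact: memv_span. Qed.

Lemma root_neq0 a : a \in Phi -> a != 0.
Proof. by have [_ h _ _ _] := hPhi; apply: contraTneq => ->. Qed.

Lemma root_reflection a b : a \in Phi -> b \in Phi -> reflection ip a b \in Phi.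
Proof. by have [_ _ h _ _] := hPhi; exact: h. Qed.

Lemma root_opp : sign_symmetric Phi.
Proof.
move=> a aP; rewrite -(reflection_root ip (root_neq0 aP)).
exact: root_reflection.
Qed.

Lemma root_span_eq0 x : U x -> (forall a, a \in Phi -> ip a x = 0) -> x = 0.
Proof.
have [-> _ _ _ _] := hPhi => /= Ux h; apply: (@ip_eq0 _ _ ip).
exact: (ip_span_eq0 h).
Qed.

Lemma sum_reflection (M : nmodType) b (P : pred V) (f : V -> M) : b \in Phi ->
  \sum_(a <- Phi | P a) f a =
  \sum_(a <- Phi | P (reflection ip b a)) f (reflection ip b a).
Proof.
move=> bP; rewrite -(big_map (reflection ip b) P f); apply: perm_big.
have inj := can_inj (reflectionK ip (root_neq0 bP)).
apply: uniq_perm; rewrite ?map_inj_uniq ?fset_uniq// => x.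
apply/idP/mapP => [xP|[y yP ->]]; last exact: root_reflection.
exists (reflection ip b x); first exact: root_reflection.
by rewrite reflectionK// root_neq0.
Qed.

(** If neither [a - b] nor [b - a] were the reflection of a root, both Cartan
    integers would be at least 2, forcing [|a - b|^2 <= 0]. *)
Lemma root_sub a b : a \in Phi -> b \in Phi -> a != b -> 0 < ip a b ->
  a - b \in Phi.
Proof.
move=> aP bP ab h.
have [_ _ _ hint _] := hPhi.
have aa := ip_gt0 ip (root_neq0 aP); have bb := ip_gt0 ip (root_neq0 bP).
have pos x : 0 < ip x x -> 2 * ip a b / ip x x \is a Num.int ->
    2 * ip a b / ip x x = 1 \/ ip x x <= ip a b.
  move=> xx; have n0 : 0 < 2 * ip a b / ip x x by rewrite divr_gt0// mulr_gt0.
  rewrite (intrEge0 (ltW n0)) => /natrP[n hn].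
  move: n0; rewrite hn ltr0n; case: n hn => [//|[|n]] hn _; [by left|right].
  have : 2%:R <= 2 * ip a b / ip x x by rewrite hn ler_nat.
  by rewrite ler_pdivlMr// -[2%:R]/(2 : R) ler_pM2l.
have [n1|na] := pos _ aa (hint _ _ aP bP).
  have := root_reflection aP bP; rewrite reflectionE n1 scale1r => /root_opp.
  by rewrite opprB.
have := hint _ _ bP aP; rewrite [ip b a]ip_sym => /(pos _ bb)[n1|nb].
  have := root_reflection bP aP.
  by rewrite reflectionE [ip b a]ip_sym n1 scale1r.
have : 0 < ip (a - b) (a - b) by rewrite ip_gt0// subr_eq0.
rewrite ipBl !ipBr [ip b a]ip_sym; lra.
Qed.

(** The simple roots are the positive roots that are not sums of two positive
    roots. They make pairwise non-acute angles because otherwise a difference of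
    two of them would be a root and decompose one of them, so they are
    independent by [free_obtuse]. *)
Lemma weight_basis_exists v : regular ip Phi v ->
  exists D lam, weight_basis ip U Phi v D lam.
Proof.
move=> rv; pose pos a := (a \in Phi) && (0 < ip a v).
pose dec a := [exists b : Phi, exists c : Phi,
  [&& pos (val b), pos (val c) & a == val b + val c]].
pose D := [fset a in Phi | pos a && ~~ dec a]%fset.
have DP a : a \in D -> [/\ a \in Phi, 0 < ip a v & ~~ dec a].
  by rewrite !inE /= => /and3P[_ /andP[-> ->]].
pose m a := #|` [fset b in Phi | ip b v < ip a v]%fset|.
have m_lt a b : b \in Phi -> ip b v < ip a v -> (m b < m a)%N.
  move=> bP ba; apply: fproper_ltn_card; rewrite fproperE; apply/andP; split.
    by apply/fsubsetP => x; rewrite !inE /= => /andP[-> /lt_trans]; apply.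
  by apply/negP => /fsubsetP/(_ b); rewrite !inE /= bP ba ltxx => /(_ isT).
(* Splitting a decomposable positive root lowers its value at [v], hence
   terminates in indecomposable ones. *)
have comb n a : (m a < n)%N -> pos a ->
    exists k : V -> nat, a = \sum_(b <- D) b *+ k b.
  elim: n a => [//|n IH] a man /andP[aP av].
  have [|nd] := boolP (dec a); last first.
    exists (fun b => (b == a) : nat).
    have aD : a \in D by rewrite !inE /= /pos aP av.
    rewrite (bigD1_seq a) ?fset_uniq//= eqxx mulr1n big1 ?addr0// => b.
    by move=> /negbTE ->; rewrite mulr0n.
  move=> /existsP[[b bP] /existsP[[c cP]]] /= /and3P[pb pc /eqP abc].
  have /andP[_ bv] := pb; have /andP[_ cv] := pc.
  have avE : ip a v = ip b v + ip c v by rewrite abc ipDl.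
  have [|k kE] := IH b _ pb.
    by rewrite (leq_trans (m_lt a b bP _))//; lra.
  have [|j jE] := IH c _ pc.
    by rewrite (leq_trans (m_lt a c cP _))//; lra.
  exists (fun x => (k x + j x)%N).
  by under eq_bigr do rewrite mulrnDr; rewrite big_split /= -kE -jE.
have obtuse : {in D &, forall a b, a != b -> ip a b <= 0}.
  move=> a b /DP[aP av na] /DP[bP bv nb] ab; rewrite leNgt; apply/negP => h.
  have abP := root_sub aP bP ab h.
  have := rv _ abP; rewrite neq_lt => /orP[ltab|gtab].
    move/negP: nb; apply; apply/existsP; exists [` root_opp abP]%fset.
    apply/existsP; exists [` aP]%fset => /=.
    by rewrite /pos aP av root_opp// ipNl oppr_gt0 ltab opprB subrK eqxx.
  move/negP: na; apply; apply/existsP; exists [` abP]%fset.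
  apply/existsP; exists [` bP]%fset => /=.
  by rewrite /pos abP gtab bP bv subrK eqxx.
have freeD : free D.
  by apply: (@free_obtuse _ _ ip _ v); rewrite ?fset_uniq// => a /DP[].
have sign_comb a : a \in Phi -> exists k : V -> nat,
    a = \sum_(b <- D) b *+ k b \/ a = - \sum_(b <- D) b *+ k b.
  move=> aP; have := rv _ aP; rewrite neq_lt => /orP[av|av].
    have [|k kE] := comb (m (- a)).+1 (- a) (ltnSn _).
      by rewrite /pos root_opp// ipNl oppr_gt0.
    by exists k; right; rewrite -kE opprK.
  have [|k kE] := comb (m a).+1 a (ltnSn _); first by rewrite /pos aP.
  by exists k; left.
have spanD : <<Phi>>%VS = <<D>>%VS.
  apply/eqP; rewrite eqEsubv; apply/andP; split; apply/span_subvP => a aP.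
    have sumD (k : V -> nat) : \sum_(b <- D) b *+ k b \in <<D>>%VS.
      by rewrite big_seq memv_suml// => b bD; rewrite rpredMn// memv_span.
    by have [k [->|->]] := sign_comb a aP; rewrite ?memvN.
  by apply: memv_span; have [] := DP _ aP.
have US : U = [set x | x \in <<D>>%VS].
  by have [-> _ _ _ _] := hPhi; rewrite spanD.
have /choice[lam hlam] a : exists l, a \in D ->
    U l /\ forall b, b \in D -> ip b l = (b == a)%:R.
  have [aD|] := boolP (a \in D); last by exists 0.
  have [w wX hw] := orthogonal_projection_exists ip (rem a D) a.
  have pD := perm_to_rem aD.
  have := freeD; rewrite (perm_free pD) free_cons => /andP[aX _].
  have e0 : a - w != 0 by rewrite subr_eq0; apply: contraNneq aX => {1}->.
  have ee := ip_gt0 ip e0.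
  have spanE : <<D>>%VS = (<[a]> + <<rem a D>>)%VS.
    by rewrite (eq_span (perm_mem pD)) span_cons.
  exists ((ip (a - w) (a - w))^-1 *: (a - w)) => _; split.
    rewrite US /= memvZ// memvB//; first exact: memv_span.
    by rewrite spanE (subvP (addvSr _ _)).
  move=> b bD; rewrite ipZr; case: (eqVneq b a) => [->|ba].
    have -> : ip a (a - w) = ip (a - w) (a - w).
      by rewrite [RHS]ipBl (hw w)// subr0.
    by rewrite mulVf// gt_eqF.
  rewrite (hw b) ?mulr0//; apply: memv_span.
  by move: bD; rewrite (perm_mem pD) inE (negbTE ba).
exists D, lam; split.
- by split=> // a /DP[].
- by move=> a /DP[].
- by move=> a /hlam[].
- by move=> a b /hlam[_ h]; exact: h.
Qed.

End RootSystem.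

(** * Weights in the closure of a chamber *)

Section Weights.
Context (R : realType) (V : vectType R) (ip : {dot V for idfun}).
Context (U : set V) (Phi : {fset V}) (hPhi : root_system ip U Phi).
Implicit Types (a b l m p q u v w x y z : V) (r s t : R) (D : {fset V}).

Let hU : subspace U := root_space_subspace hPhi.
Let hs : sign_symmetric Phi := root_opp hPhi.

Lemma vert_specializes p l : U p -> vert ip U Phi (face ip U Phi p) l ->
  U l /\ specializes ip Phi p l.
Proof. by move=> Up [[Ul _] /cl_face h]; split=> //; exact: h. Qed.

Lemma face0 : face ip U Phi 0 = [set 0].
Proof.
apply/seteqP; split=> [x [Ux h]|_ ->]; last by apply: face_refl; exact: hU.1.
apply: (root_span_eq0 hPhi Ux) => a aP.
exact: (specializes_eq0 hs (same_facet_specializes h) aP (ip0r ip a)).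
Qed.

Section Basis.
Context (v : V) (rv : regular ip Phi v).
Context (D : {fset V}) (lam : V -> V) (hD : weight_basis ip U Phi v D lam).

Lemma wb_root a : a \in D -> a \in Phi.
Proof. by have [h _ _ _] := wb_simple hD; exact: h. Qed.

Lemma wb_combination (f : V -> R) b : b \in D ->
  ip b (\sum_(a <- D) f a *: lam a) = f b.
Proof.
move=> bD; rewrite ip_sumr (bigD1_seq b) ?fset_uniq//= ipZr (wb_dual hD)//.
rewrite eqxx mulr1 big_seq_cond big1 ?addr0// => a /andP[aD ab].
by rewrite ipZr (wb_dual hD)// eq_sym (negbTE ab) mulr0.
Qed.

Lemma wb_mem_combination (f : V -> R) : U (\sum_(a <- D) f a *: lam a).
Proof.
apply: subspace_sum => // a aD _; apply: subspaceZ => //.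
exact: (wb_mem hD aD).
Qed.

Lemma simple_span_eq0 x : U x -> {in D, forall a, ip a x = 0} -> x = 0.
Proof.
have [_ _ US _] := wb_simple hD; rewrite US => /= xD h.
by apply: (@ip_eq0 _ _ ip); exact: (ip_span_eq0 h).
Qed.

Lemma weight_expansion x : U x -> x = \sum_(a <- D) ip a x *: lam a.
Proof.
move=> Ux; apply/eqP; rewrite -subr_eq0; apply/eqP; apply: simple_span_eq0.
  by apply: subspaceB => //; exact: wb_mem_combination.
by move=> b bD; rewrite ipBr wb_combination// subrr.
Qed.

Lemma wb_root_weight a b : a \in Phi -> 0 < ip a v -> b \in D ->
  exists n : nat, ip a (lam b) = n%:R.
Proof.
move=> aP av bD; have [_ _ _ /(_ a aP)[k hk]] := wb_simple hD.
have kE c : ip (\sum_(b <- D) b *+ k b) c = \sum_(b <- D) ip b c *+ k b.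
  rewrite ip_suml; apply: eq_bigr => e _.
  by rewrite -scaler_nat ipZl mulr_natl.
case: hk => aE.
  exists (k b); rewrite aE kE (bigD1_seq b) ?fset_uniq//= (wb_dual hD)// eqxx.
  rewrite big_seq_cond big1 ?addr0// => c /andP[cD cb].
  by rewrite (wb_dual hD)// (negbTE cb) mul0rn.
suff : ip a v <= 0 by rewrite leNgt av.
rewrite aE ipNl oppr_le0 kE big_seq sumr_ge0// => c cD.
by rewrite mulrn_wge0// ltW// (wb_pos hD).
Qed.

(** The face of a point of the closed chamber is spanned by the weights with
    positive coefficient: a root nonnegative at the point but negative on the
    chamber pairs nonpositively with every weight, so it kills each weight
    that occurs. *)
Lemma specializes_weight x a : U x -> specializes ip Phi v x -> a \in D ->
  0 < ip a x -> specializes ip Phi x (lam a).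
Proof.
move=> Ux vx aD ax r rP rx.
have := rv rP; rewrite neq_lt => /orP[rv0|rv0]; last first.
  by have [n ->] := wb_root_weight rP rv0 aD; exact: ler0n.
have rv0' : 0 < ip (- r) v by rewrite ipNl oppr_gt0.
have nonneg b : b \in D -> 0 <= ip b x * ip (- r) (lam b).
  move=> bD; have [n ->] := wb_root_weight (hs rP) rv0' bD.
  by rewrite mulr_ge0// vx ?wb_root// ltW// (wb_pos hD).
have sumE : ip (- r) x = \sum_(b <- D) ip b x * ip (- r) (lam b).
  rewrite {1}(weight_expansion Ux) ip_sumr.
  by apply: eq_bigr => b _; exact: ipZr.
have : \sum_(b <- D) ip b x * ip (- r) (lam b) == 0.
  by rewrite eq_le -{1}sumE ipNl oppr_le0 rx big_seq sumr_ge0.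
rewrite big_seq psumr_eq0// => /allP/(_ a aD); rewrite aD /= mulf_eq0.
by rewrite gt_eqF//= ipNl oppr_eq0 => /eqP ->.
Qed.

Lemma weight_dominant a : U v -> a \in D -> specializes ip Phi v (lam a).
Proof.
by move=> Uv aD; apply: specializes_weight => //; exact: wb_pos hD _ aD.
Qed.

Lemma weight_fundamental a : a \in D ->
  fundamental_dominant_weight ip U Phi (lam a).
Proof.
move=> aD; split; first exact: wb_mem hD _ aD.
exists D; first exact: wb_simple hD; exists a => //; split.
  by rewrite (wb_dual hD)// eqxx.
by move=> b bD ba; rewrite (wb_dual hD)// (negbTE ba).
Qed.

Lemma weight_vert x a : U x -> specializes ip Phi v x -> a \in D ->
  0 < ip a x -> vert ip U Phi (face ip U Phi x) (lam a).
Proof.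
move=> Ux vx aD ax; split; first exact: weight_fundamental.
apply/cl_face => //; first exact: wb_mem hD _ aD.
exact: specializes_weight.
Qed.

(** A fundamental weight [m] of another system of simple roots spans a line cut
    out by roots. Some weight [lam a] of the chamber lies on every root
    hyperplane through [m], hence on this line, and integrality of the
    pairings with roots excludes any factor but 1. *)
Lemma fundamental_weight_unique m : fundamental_dominant_weight ip U Phi m ->
  specializes ip Phi v m -> exists2 a, a \in D & m = lam a.
Proof.
move=> [Um [E [EP _ UE Ecomb] [e eE [em1 em0]]]] vm.
have eP := EP _ eE.
have [a aD am] : exists2 a, a \in D & 0 < ip a m.
  apply: contrapT => h; have m0 : m = 0.
    apply: simple_span_eq0 => // a aD; apply/eqP; rewrite eq_le.
    rewrite [0 <= _]vm ?wb_root ?(ltW (wb_pos hD aD))// andbT leNgt.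
    by apply/negP => am; apply: h; exists a.
  by move: em1; rewrite m0 ip0r => /esym/eqP; rewrite oner_eq0.
exists a => //.
have Ula := wb_mem hD aD.
have ml := specializes_weight Um vm aD am.
have lamE : lam a = ip e (lam a) *: m.
  apply/eqP; rewrite -subr_eq0; apply/eqP; apply: (@ip_eq0 _ _ ip).
  have Uz : U (lam a - ip e (lam a) *: m).
    by apply: subspaceB => //; exact: subspaceZ.
  apply: (ip_span_eq0 (X := E)); last by move: Uz; rewrite {1}UE.
  move=> b bE; rewrite ipBr ipZr; have [->|be] := eqVneq b e.
    by rewrite em1 mulr1 subrr.
  by rewrite em0// mulr0 subr0 (specializes_eq0 hs ml (EP _ bE))// em0.
have [k ak] : exists k : nat, ip a m = k%:R.
  have [k hk] := Ecomb a (wb_root aD); exists (k e).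
  have kE : ip (\sum_(b <- E) b *+ k b) m = (k e)%:R.
    rewrite ip_suml (bigD1_seq e) ?fset_uniq//= -scaler_nat ipZl em1 mulr1.
    rewrite big_seq_cond big1 ?addr0// => c /andP[cE ce].
    by rewrite -scaler_nat ipZl em0// mulr0.
  move: am; case: hk => ->; rewrite ?ipNl kE// oppr_gt0 ltNge ler0n//.
have la1 : ip a (lam a) = 1 by rewrite (wb_dual hD)// eqxx.
have ev : 0 < ip e v.
  by apply: (specializes_lt hs vm eP); rewrite em1.
have [n en] := wb_root_weight eP ev aD.
move: la1; rewrite {1}lamE ipZr ak en -natrM => /eqP.
rewrite pnatr_eq1 muln_eq1 => /andP[/eqP n1 _].
by rewrite lamE en n1 scale1r.
Qed.

End Basis.

Lemma regular_exists : exists2 v, U v & regular ip Phi v.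
Proof.
suff [v Uv hv] : exists2 v, U v &
    forall a, a \in (Phi : seq V) -> ip a v != 0 by exists v.
have : {subset (Phi : seq V) <= Phi} by [].
elim: (Phi : seq V) => [_|b s IH sP]; first by exists 0; [exact: hU.1|].
have [|v Uv hv] := IH; first by move=> a ha; apply: sP; rewrite inE ha orbT.
have bP : b \in Phi by apply: sP; rewrite mem_head.
have [bv|bv] := eqVneq (ip b v) 0; last first.
  by exists v => // a; rewrite inE => /orP[/eqP->|/hv].
have [t t0 ht] := small_displacement ip Phi v b; exists (v + t *: b).
  by apply: subspaceD => //; apply: subspaceZ => //; exact: (root_mem hPhi bP).
move=> a asb; rewrite -sgr_eq0 ht ?sP//; move: asb; rewrite inE.
move=> /orP[/eqP->|/hv av]; last by rewrite (negbTE av) sgr_eq0.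
by rewrite bv eqxx sgr_eq0 gt_eqF// ip_gt0// (root_neq0 hPhi).
Qed.

(** Displace [p] slightly in a regular direction. *)
Lemma chamber_exists p : U p ->
  exists v, [/\ U v, regular ip Phi v & specializes ip Phi v p].
Proof.
move=> Up; have [w Uw rw] := regular_exists.
have [t t0 ht] := small_displacement ip Phi p w.
exists (p + t *: w); split.
- by apply: subspaceD => //; exact: subspaceZ.
- by move=> a aP; rewrite -sgr_eq0 ht//; case: ifPn; rewrite sgr_eq0// rw.
- move=> a aP; rewrite -sgr_ge0 ht//; case: eqP => [->//|_].
  by rewrite sgr_ge0.
Qed.

Lemma chamber_ofP p : U p -> exists v, [/\ U v, regular ip Phi v,
  specializes ip Phi v p &
  chamber_of ip U Phi (face ip U Phi p) = face ip U Phi v].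
Proof.
move=> Up; have [v [Uv rv vp]] := chamber_exists Up.
have hv : weyl_chamber ip U Phi (face ip U Phi v) /\
    facet_ge ip (face ip U Phi p) (face ip U Phi v).
  by split; [apply/weyl_chamberP => //; exists v|apply/facet_ge_face].
rewrite /chamber_of; case: xgetP => [c _ [hc pc]|/(_ _ hv)//].
have [w [Uw rw cE]] := (weyl_chamberP ip Phi c hU).1 hc; exists w; split=> //.
by move: pc; rewrite cE => /(facet_ge_face ip hU hs Up Uw).
Qed.

(** * The degree of a facet *)

(** The roots orthogonal to [p] cancel in opposite pairs. At a regular point
    this is twice the classical vector rho of the chamber. *)
Definition nonneg_root_sum p := \sum_(a <- Phi | 0 <= ip a p) a.

Lemma nonneg_root_sum_mem p : U (nonneg_root_sum p).
Proof. by apply: subspace_sum => // a aP _; exact: (root_mem hPhi aP). Qed.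

Lemma ip_nonneg_root_sum_reflection p b : b \in Phi ->
  ip b (nonneg_root_sum p) =
  \sum_(a <- Phi | 0 <= ip (reflection ip b a) p) - ip b a.
Proof.
move=> bP; rewrite ip_sumr (sum_reflection hPhi (fun a => 0 <= ip a p) _ bP).
by apply: eq_bigr => a _; rewrite ip_root_reflection// (root_neq0 hPhi).
Qed.

Lemma ip_nonneg_root_sum_eq0 p b : b \in Phi -> ip b p = 0 ->
  ip b (nonneg_root_sum p) = 0.
Proof.
move=> bP bp.
suff : ip b (nonneg_root_sum p) = - ip b (nonneg_root_sum p) by lra.
rewrite {1}ip_nonneg_root_sum_reflection// ip_sumr -sumrN.
by apply: eq_bigl => a; rewrite ip_reflection reflection_id.
Qed.

(** Averaging over the reflection in [b]: it lowers the value at [p] of the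
    roots acute to [b] and raises that of the obtuse ones, so of the two
    members of an orbit the acute one occurs in the sum whenever the other
    does; the orbit of [b] itself contributes strictly. *)
Lemma ip_nonneg_root_sum_gt0 p b : b \in Phi -> 0 < ip b p ->
  0 < ip b (nonneg_root_sum p).
Proof.
move=> bP bp; have b0 := root_neq0 hPhi bP; have bb := ip_gt0 ip b0.
suff : 0 < ip b (nonneg_root_sum p) + ip b (nonneg_root_sum p) by lra.
rewrite {2}ip_nonneg_root_sum_reflection// ip_sumr.
rewrite [X in X + _]big_mkcond [X in _ + X]big_mkcond -big_split /=.
rewrite (bigD1_seq b) ?fset_uniq//= reflection_root// ipNl (ltW bp).
rewrite oppr_ge0 leNgt bp /= addr0 ltr_wpDr// sumr_ge0// => a _.
rewrite reflectionE ipBl ipZl -mulrA -mulrA.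
case: ifPn => [a1|]; case: ifPn => [a2|] //; rewrite ?addr0 ?add0r ?subrr//.
  rewrite -ltNge => a2; have : 0 < 2 * (ip b a * ((ip b b)^-1 * ip b p)) by lra.
  rewrite pmulr_rgt0// pmulr_lgt0; first exact: ltW.
  by rewrite mulr_gt0// invr_gt0.
rewrite -ltNge => a1; have : 2 * (ip b a * ((ip b b)^-1 * ip b p)) < 0 by lra.
rewrite pmulr_rlt0// pmulr_llt0; first by rewrite oppr_ge0; exact: ltW.
by rewrite mulr_gt0// invr_gt0.
Qed.

Lemma nonneg_root_sum_face p : same_facet ip Phi p (nonneg_root_sum p).
Proof.
move=> b bP; case: (ltrgt0P (ip b p)) => bp.
- by apply: Or32; rewrite ip_nonneg_root_sum_gt0.
- apply: Or33; split=> //; have := @ip_nonneg_root_sum_gt0 p _ (hs bP).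
  by rewrite !ipNl !oppr_gt0; exact.
- by apply: Or31; rewrite ip_nonneg_root_sum_eq0.
Qed.

(** The weights of a facet span it: [p] is a combination of them with positive
    coefficients. *)
Lemma R_rootsP p a : U p -> a \in Phi ->
  (a \in R_roots ip U Phi (face ip U Phi p)) = (0 <= ip a p).
Proof.
move=> Up aP; apply/idP/idP; rewrite inE /R_roots /=; last first.
  move=> ap; split=> // l /(vert_specializes Up)[_]; exact.
move=> [_ h].
have [v [Uv rv vp]] := chamber_exists Up.
have [D [lam hD]] := weight_basis_exists hPhi rv.
rewrite (weight_expansion hD Up) ip_sumr big_seq sumr_ge0// => b bD.
have : 0 <= ip b p by rewrite vp ?(wb_root hD)// ltW// (wb_pos hD).
rewrite ipZr le_eqVlt => /orP[/eqP <-|bp]; first by rewrite mul0r.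
apply: mulr_ge0; first exact: ltW.
apply: h; apply: (weight_vert rv hD) => //.
Qed.

Lemma deg_nonneg_root_sum d p : U p ->
  deg ip U Phi d (face ip U Phi p) =
  d (chamber_of ip U Phi (face ip U Phi p)) (nonneg_root_sum p).
Proof.
move=> Up; rewrite linear_sum /deg big_seq_cond [RHS]big_seq_cond.
by apply: eq_bigl => a; case: (boolP (a \in Phi)) => //= aP; exact: R_rootsP.
Qed.

(** * Complementary polyhedra as piecewise linear functions *)

Section Polyhedron.
Context (d : set V -> 'Hom(V, R^o)).
Context (hd : complementary_polyhedron ip U Phi d).

(** Agreement on common weights is agreement on common points of closed
    chambers, the weights that occur in such a point being common. *)
Lemma polyhedron_agree v u x :
  U v -> regular ip Phi v -> U u -> regular ip Phi u -> U x ->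
  specializes ip Phi v x -> specializes ip Phi u x ->
  d (face ip U Phi v) x = d (face ip U Phi u) x.
Proof.
move=> Uv rv Uu ru Ux vx ux.
have [D [lam hD]] := weight_basis_exists hPhi rv.
rewrite (weight_expansion hD Ux) !linear_sum; apply: eq_big_seq => a aD.
have : 0 <= ip a x by rewrite vx ?(wb_root hD)// ltW// (wb_pos hD).
rewrite le_eqVlt => /orP[/eqP <-|ax]; first by rewrite scale0r !linear0.
have [_ hA _] := hd; rewrite !linearZ /=; congr (_ *: _); apply: hA.
- by apply/weyl_chamberP => //; exists v.
- by apply/weyl_chamberP => //; exists u.
- have al := specializes_weight rv hD Ux vx aD ax.
  have Ul := wb_mem hD aD.
  split; split; try exact: (weight_fundamental hD).
    by apply/cl_face => //; exact: specializes_trans al.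
  by apply/cl_face => //; exact: specializes_trans al.
Qed.

Section Semistable.
Context (hss : semistable ip U Phi d).

(** On the ray of a fundamental weight [lam a] the degree is a positive
    multiple of the value of [d] at [lam a]; these values determine all
    others. *)
Lemma semistable_le0 v x : U v -> regular ip Phi v -> U x ->
  specializes ip Phi v x -> d (face ip U Phi v) x <= 0.
Proof.
move=> Uv rv Ux vx.
have [D [lam hD]] := weight_basis_exists hPhi rv.
rewrite (weight_expansion hD Ux) linear_sum big_seq sumr_le0// => a aD.
have Ul := wb_mem hD aD.
have al1 : ip a (lam a) = 1 by rewrite (wb_dual hD)// eqxx.
have l0 : lam a != 0.
  by apply/eqP => l0; move/eqP: al1; rewrite l0 ip0r eq_sym oner_eq0.
rewrite linearZ /=; apply: mulr_ge0_le0.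
  by rewrite vx ?(wb_root hD)// ltW// (wb_pos hD).
pose w := nonneg_root_sum (lam a).
have wE : w = ip a w *: lam a.
  rewrite [LHS](weight_expansion hD (nonneg_root_sum_mem (lam a))).
  rewrite (bigD1_seq a) ?fset_uniq//= big_seq_cond big1 ?addr0// => b.
  move=> /andP[bD ba]; rewrite ip_nonneg_root_sum_eq0 ?scale0r ?(wb_root hD)//.
  by rewrite (wb_dual hD)// (negbTE ba).
have w0 : 0 < ip a w by rewrite ip_nonneg_root_sum_gt0 ?(wb_root hD)// al1.
have : deg ip U Phi d (face ip U Phi (lam a)) <= 0.
  apply: hss; first by exists (lam a).
  move=> /seteqP[/(_ (lam a)) h _]; move/eqP: l0; apply; apply: h.
  exact: face_refl.
rewrite deg_nonneg_root_sum//.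
have [u [Uu ru ul ->]] := chamber_ofP Ul.
have vl := weight_dominant rv hD Uv aD.
by rewrite -/w wE linearZ /= -(@polyhedron_agree v u)// pmulr_rle0.
Qed.

(** A combination of nonpositive values with positive coefficients vanishes only
    if each value does. *)
Lemma semistable_eq0 v x a (D : {fset V}) lam : U v -> regular ip Phi v ->
  weight_basis ip U Phi v D lam -> U x -> specializes ip Phi v x ->
  d (face ip U Phi v) x = 0 -> a \in D -> 0 < ip a x ->
  d (face ip U Phi v) (lam a) = 0.
Proof.
move=> Uv rv hD Ux vx; rewrite {1}(weight_expansion hD Ux) linear_sum => /eqP.
have nonpos b : b \in D -> d (face ip U Phi v) (ip b x *: lam b) <= 0.
  move=> bD; have Ul := wb_mem hD bD.
  rewrite linearZ /=; apply: mulr_ge0_le0.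
    by rewrite vx ?(wb_root hD)// ltW// (wb_pos hD).
  by apply: semistable_le0 => //; exact: (weight_dominant rv hD).
rewrite -oppr_eq0 -sumrN big_seq psumr_eq0; last first.
  by move=> b /nonpos; rewrite oppr_ge0.
move=> /allP h aD ax.
move: (h a aD); rewrite aD oppr_eq0 linearZ /= mulf_eq0 gt_eqF//=.
by move=> /eqP.
Qed.

(** * The numerical condition as vanishing *)

(** The vector at which [d] takes the value [n_inv]. For a weight [l] of the
    facet it is a multiple of the projection, to the span of the facet, of the
    simple root dual to [l]. *)
Definition psi_sum p l :=
  \sum_(a <- Phi | a \in Psi_roots ip U Phi (face ip U Phi p) l) a.

Lemma n_inv_psi_sum p l : n_inv ip U Phi d (face ip U Phi p) l =
  d (chamber_of ip U Phi (face ip U Phi p)) (psi_sum p l).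
Proof. by rewrite linear_sum. Qed.

Lemma psi_sum_mem p l : U (psi_sum p l).
Proof. by apply: subspace_sum => // a aP _; exact: (root_mem hPhi aP). Qed.

(** The roots orthogonal to the facet generate reflections that permute the
    set defining [psi_sum]. *)
Lemma ip_psi_sum_eq0 p l b : U p -> vert ip U Phi (face ip U Phi p) l ->
  b \in Phi -> ip b p = 0 -> ip b (psi_sum p l) = 0.
Proof.
move=> Up vl bP bp.
have fixed m : vert ip U Phi (face ip U Phi p) m -> reflection ip b m = m.
  move=> /(vert_specializes Up)[_ pm]; apply: reflection_id.
  exact: (specializes_eq0 hs pm).
suff : ip b (psi_sum p l) = - ip b (psi_sum p l) by lra.
rewrite /psi_sum ip_sumr [LHS](sum_reflection hPhi _ _ bP) -sumrN.
rewrite [LHS]big_seq_cond [RHS]big_seq_cond.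
apply: eq_big => [a|a _]; last by rewrite ip_root_reflection// (root_neq0 hPhi).
case: (boolP (a \in Phi)) => //= aP; apply/idP/idP; rewrite !inE /Psi_roots /=.
  move=> [_ al am]; split=> //; first by rewrite -al ip_reflection fixed.
  by move=> m vm ml; rewrite -(am m vm ml) ip_reflection fixed.
move=> [_ al am]; split; first exact: root_reflection hPhi _ _ bP aP.
  by rewrite ip_reflection fixed.
by move=> m vm ml; rewrite ip_reflection fixed// am.
Qed.

(** On the span of the facet, which contains the vectors [psi_sum], a
    semistable [d] vanishes as soon as it vanishes at the interior point [p],
    because its values at the weights spanning the facet have one sign.
    Conversely the vectors [psi_sum], one for each weight of the facet, are
    multiples of the projections of its simple roots, hence span it. *)
Lemma J1P u p : U u -> regular ip Phi u -> U p -> specializes ip Phi u p ->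
  J1 ip U Phi d (face ip U Phi p) <-> d (face ip U Phi u) p = 0.
Proof.
move=> Uu ru Up up.
have [v [Uv rv vp cE]] := chamber_ofP Up.
rewrite (polyhedron_agree Uu ru Uv rv Up up vp) {u Uu ru up}.
have [D [lam hD]] := weight_basis_exists hPhi rv.
have p_ge0 a : a \in D -> 0 <= ip a p.
  by move=> aD; rewrite vp ?(wb_root hD)// ltW// (wb_pos hD).
split=> [hJ|dp0 l vl]; last first.
  rewrite n_inv_psi_sum cE (weight_expansion hD (psi_sum_mem p l)) linear_sum.
  rewrite big_seq big1// => a aD; rewrite linearZ /=.
  have := p_ge0 a aD; rewrite le_eqVlt => /orP[/eqP/esym ap|ap].
    by rewrite ip_psi_sum_eq0 ?(wb_root hD)// scale0r.
  by rewrite (semistable_eq0 Uv rv hD Up vp dp0 aD ap) scaler0.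
pose I a := 0 < ip a p.
have lv a : a \in D -> I a -> vert ip U Phi (face ip U Phi p) (lam a).
  by move=> aD aI; apply: (weight_vert rv hD).
pose N a := ip (psi_sum p (lam a)) (lam a).
have aPsi a : a \in D -> I a ->
    a \in Psi_roots ip U Phi (face ip U Phi p) (lam a).
  move=> aD aI; rewrite inE; split; first exact: wb_root hD _ aD.
    by rewrite (wb_dual hD)// eqxx.
  move=> m vm ml; have [Um pm] := vert_specializes Up vm.
  have vm' := specializes_trans vp pm.
  have [b bD mE] := fundamental_weight_unique rv hD vm.1 vm'.
  rewrite mE (wb_dual hD)//; case: eqVneq => // ab.
  by case: ml; rewrite mE -ab.
have psiE a b : a \in D -> b \in D -> I a -> I b ->
    ip (psi_sum p (lam a)) (lam b) = (a == b)%:R * N a.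
  move=> aD bD aI bI; have [<-|ab] := eqVneq a b; first by rewrite mul1r.
  rewrite mul0r ip_suml big1// => c; rewrite inE => -[_ _ h].
  apply: h; first exact: lv.
  move=> lab; have := wb_dual hD aD aD; have := wb_dual hD bD aD.
  by rewrite lab eqxx (negbTE ab) => ->/eqP; rewrite eq_sym oner_eq0.
have N0 a : a \in D -> I a -> N a != 0.
  move=> aD aI; apply: lt0r_neq0; rewrite /N ip_suml.
  rewrite (big_rem a) ?(wb_root hD)//= aPsi// (wb_dual hD)// eqxx.
  by rewrite ltr_wpDr// sumr_ge0// => c; rewrite inE => -[_ -> _].
have pE : p = \sum_(a <- D | I a) (ip p (lam a) / N a) *: psi_sum p (lam a).
  apply/eqP; rewrite -subr_eq0; apply/eqP; set z := _ - _.
  have Uz : U z.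
    apply: subspaceB => //; apply: subspace_sum => // a aD _.
    by apply: subspaceZ => //; exact: psi_sum_mem.
  apply: (@ip_eq0 _ _ ip); rewrite {2}(weight_expansion hD Uz) ip_sumr.
  rewrite big_seq big1// => b bD; rewrite ipZr.
  have := p_ge0 b bD; rewrite le_eqVlt => /orP[/eqP/esym bp|bI].
    rewrite {1}/z ipBr bp sub0r ip_sumr big_seq_cond big1 ?oppr0 ?mul0r//.
    move=> a /andP[aD aI]; rewrite ipZr ip_psi_sum_eq0 ?mulr0 ?(wb_root hD)//.
    exact: lv.
  rewrite {2}/z ipBl ip_suml (big_rem b)//= [I b]bI big_seq_cond big1.
    by rewrite ipZl psiE// eqxx mul1r divfK ?N0// addr0 subrr mulr0.
  move=> a /andP[]; rewrite mem_rem_uniq ?fset_uniq// inE => /andP[ab aD] aI.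
  by rewrite ipZl psiE// (negbTE ab) mul0r mulr0.
rewrite pE linear_sum big_seq_cond big1// => a /andP[aD aI].
by rewrite linearZ /= -cE -n_inv_psi_sum hJ ?scaler0//; exact: lv.
Qed.

End Semistable.
End Polyhedron.
End Weights.

(** * The Levi root system *)

Section Levi.
Context (R : realType) (V : vectType R) (ip : {dot V for idfun}).
Context (U : set V) (Phi : {fset V}) (hPhi : root_system ip U Phi).
Context (p : V) (Up : U p).
Implicit Types (a b l q u v w x y z : V) (r s t : R).

Let hU : subspace U := root_space_subspace hPhi.
Let hs : sign_symmetric Phi := root_opp hPhi.
Let P := face ip U Phi p.
Let W := levi_space ip U P.
Let PhiP := levi_roots ip U Phi P.

Lemma face_add y : U y -> specializes ip Phi p y -> P (p + y).
Proof.
move=> Uy py; split; first exact: subspaceD.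
apply: (same_facet_specializesP hs) => a aP.
  by move=> ap; rewrite ipDr addr_ge0// py.
rewrite ipDr => apy; rewrite leNgt; apply/negP => ap.
have := py _ (hs aP); rewrite !ipNl !oppr_ge0 => /(_ (ltW ap)); lra.
Qed.

Lemma levi_perp x y : W x -> U y -> specializes ip Phi p y -> ip y x = 0.
Proof.
move=> [_ Wx] Uy py; have := Wx _ (face_add Uy py).
by rewrite ipDl Wx ?add0r//; exact: face_refl.
Qed.

Lemma levi_perp_base x : W x -> ip p x = 0.
Proof. by move=> Wx; apply: levi_perp. Qed.

Lemma levi_rootsP a : (a \in PhiP) = (a \in Phi) && (ip a p == 0).
Proof.
rewrite !inE /=; case: (boolP (a \in Phi)) => //= aP.
apply/idP/idP => [/set_mem|/eqP ap].
  by move=> /levi_perp_base; rewrite ip_sym => ->.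
apply/mem_set; split; first exact: (root_mem hPhi aP).
move=> x [_ /same_facet_specializes px].
by rewrite ip_sym (specializes_eq0 hs px aP ap).
Qed.

Lemma levi_subspace : subspace W.
Proof.
split=> [|r x y [Ux Wx] [Uy Wy]].
  by split=> [|z _]; [exact: hU.1|rewrite ip0r].
split=> [|z Pz]; first exact: hU.2.
by rewrite ipDr ipZr Wx// Wy// mulr0 addr0.
Qed.

Lemma levi_root_mem a : a \in PhiP -> W a.
Proof. by rewrite !inE /= => /andP[_]; rewrite inE. Qed.

(** A vector of [W] orthogonal to [PhiP] is orthogonal to itself: in the dual
    bases of a chamber around the facet, each simple root lies in [PhiP] or its
    weight lies in the closure of the facet. *)
Lemma levi_space_span : W = [set x | x \in <<PhiP>>%VS].
Proof.
have spanW x : x \in <<PhiP>>%VS -> W x.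
  move=> /(@coord_span _ _ _ (in_tuple PhiP)) ->.
  apply: subspace_sum => [|i _ _]; first exact: levi_subspace.
  apply: subspaceZ; first exact: levi_subspace.
  by apply: levi_root_mem; rewrite mem_nth.
apply/seteqP; split=> x /=; last exact: spanW.
move=> Wx; have [y yP hy] := orthogonal_projection_exists ip PhiP x.
suff /eqP : x - y = 0 by rewrite subr_eq0 => /eqP ->.
have Wy := spanW _ yP.
have Wz : W (x - y) by apply: subspaceB => //; exact: levi_subspace.
have [v [Uv rv vp]] := chamber_exists hPhi Up.
have [D [lam hD]] := weight_basis_exists hPhi rv.
apply: (@ip_eq0 _ _ ip).
rewrite {2}(weight_expansion hPhi hD Wz.1) ip_sumr big_seq.
rewrite big1// => a aD; rewrite ipZr.
have aP := wb_root hD aD.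
have : 0 <= ip a p by rewrite vp// ltW// (wb_pos hD).
rewrite le_eqVlt => /orP[/eqP/esym ap|ap].
  by rewrite hy ?mul0r//; apply: memv_span; rewrite levi_rootsP aP ap eqxx.
rewrite [X in _ * X]ip_sym (@levi_perp _ (lam a) Wz) ?mulr0//.
  exact: (wb_mem hD aD).
exact: (specializes_weight hPhi rv hD).
Qed.

Lemma levi_root_system : root_system ip W PhiP.
Proof.
have [_ P0 Prefl Pint Pred] := hPhi.
have sub a : a \in PhiP -> a \in Phi by rewrite levi_rootsP => /andP[].
split.
- exact: levi_space_span.
- by apply: contra P0 => /sub.
- move=> a b; rewrite !levi_rootsP => /andP[aP /eqP ap] /andP[bP bp].
  by rewrite Prefl// ip_reflection reflection_id.
- by move=> a b /sub aP /sub bP; exact: Pint.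
- by move=> a /sub aP t /sub; exact: Pred.
Qed.

Let hPhiP := levi_root_system.

Lemma orth_projP x : W (orth_proj ip W x) /\
  forall z, W z -> ip z (x - orth_proj ip W x) = 0.
Proof.
have [y yP hy] := orthogonal_projection_exists ip PhiP x.
have WE z : W z <-> z \in <<PhiP>>%VS by rewrite levi_space_span.
rewrite /orth_proj; case: xgetP => [z _ //|/(_ y)[]].
by split=> [|z /WE]; [exact/WE|exact: hy].
Qed.

Lemma ip_orth_proj x z : W z -> ip z (orth_proj ip W x) = ip z x.
Proof.
move=> /(orth_projP x).2; rewrite ipBr => /eqP; rewrite subr_eq0 => /eqP ->.
by [].
Qed.

Lemma orth_proj_unique x y : W y -> (forall z, W z -> ip z x = ip z y) ->
  orth_proj ip W x = y.
Proof.
move=> Wy h; apply/eqP; rewrite -subr_eq0; apply/eqP; apply: (@ip_eq0 _ _ ip).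
have Wz : W (orth_proj ip W x - y).
  by apply: subspaceB => //; [exact: levi_subspace|exact: (orth_projP x).1].
by rewrite ipBr ip_orth_proj// h// subrr.
Qed.

(** * Chambers around a facet *)

(** [x] has the signs of [p + t *: y] for small positive [t]. *)
Definition lifts y x := forall a, a \in Phi ->
  Num.sg (ip a x) = if ip a p == 0 then Num.sg (ip a y) else Num.sg (ip a p).

Lemma lift_exists y : exists2 t, 0 < t & lifts y (p + t *: y).
Proof. exact: small_displacement. Qed.

(** Points [p + t *: y] specialize to each other, for small [t], as the
    directions [y] do in the Levi root system. *)
Lemma lift_specializes v y w x : lifts v w -> lifts y x ->
  specializes ip PhiP v y -> specializes ip Phi w x.
Proof.
move=> hw hx vy a aP; rewrite -sgr_ge0 hw// -[0 <= ip a x]sgr_ge0 hx//.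
case: (boolP (ip a p == 0)) => // ap; rewrite !sgr_ge0; apply: vy.
by rewrite levi_rootsP aP.
Qed.

Lemma lift_specializes_base y x : lifts y x -> specializes ip Phi x p.
Proof.
move=> hx a aP; rewrite -sgr_ge0 hx//; case: eqP => [->//|_].
by rewrite sgr_ge0.
Qed.

Lemma lift_regular v w : regular ip PhiP v -> lifts v w -> regular ip Phi w.
Proof.
move=> rv hw a aP; rewrite -sgr_eq0 hw//; case: ifPn; rewrite sgr_eq0// => ap.
by apply: rv; rewrite levi_rootsP aP.
Qed.

Lemma same_facet_lift y z x : same_facet ip PhiP y z -> lifts y x -> lifts z x.
Proof.
move=> /same_facetP yz hx a aP; rewrite hx//; case: ifP => // ap.
by rewrite yz// levi_rootsP aP.
Qed.

Lemma lift_same_facet y x z : lifts y x -> lifts y z -> same_facet ip Phi x z.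
Proof. by move=> hx hz; apply/same_facetP => a aP; rewrite hx// hz. Qed.

(** Every point whose facet has [p] in its closure has the signs of a small
    displacement of [p], in the direction of its projection. *)
Lemma orth_proj_lift y : specializes ip Phi y p -> lifts (orth_proj ip W y) y.
Proof.
move=> yp a aP; case: ifPn => [ap|].
  by rewrite ip_orth_proj//; apply: levi_root_mem; rewrite levi_rootsP aP.
case: (ltrgt0P (ip a p)) => // ap _.
  by rewrite !gtr0_sg//; exact: (specializes_lt hs yp).
rewrite !ltr0_sg//; have := specializes_lt hs yp (hs aP).
by rewrite !ipNl !oppr_gt0; exact.
Qed.

Lemma lift_reflection a v w : a \in PhiP -> lifts v w ->
  lifts (reflection ip a v) (reflection ip a w).
Proof.
rewrite levi_rootsP => /andP[aP /eqP ap] vw b bP.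
have bP' := root_reflection hPhi aP bP.
by rewrite -!ip_reflection vw// ip_reflection reflection_id.
Qed.

(** A small displacement [p + s *: y] becomes, after scaling by [s^-1], a point
    of the same chamber that projects onto [y] itself. *)
Lemma lift_chamber_image v w : U w -> lifts v w ->
  orth_proj ip W @` face ip U Phi w = face ip W PhiP v.
Proof.
move=> Uw vw; apply/seteqP; split=> [_ [u [Uu /same_facetP wu] <-]|y [Wy vy]].
  split; first exact: (orth_projP u).1.
  apply/same_facetP => a aP; rewrite ip_orth_proj; last exact: levi_root_mem.
  move: aP; rewrite levi_rootsP => /andP[aP ap].
  by rewrite -wu// vw// ap.
have [s s0 hy] := lift_exists y.
have sE : s^-1 *: (p + s *: y) = s^-1 *: p + y.
  by rewrite scalerDr scalerA mulVf ?gt_eqF// scale1r.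
exists (s^-1 *: p + y); last first.
  apply: orth_proj_unique => // z Wz.
  by rewrite ipDr ipZr ip_sym levi_perp_base// mulr0 add0r.
split; first by apply: hU.2 => //; exact: Wy.1.
apply/same_facetP => a aP.
rewrite -sE ipZr sgrM [Num.sg s^-1]gtr0_sg ?invr_gt0// mul1r.
by rewrite vw// (same_facet_lift (same_facetC vy) hy).
Qed.

(** * The Levi factor of a complementary polyhedron *)

Section Factor.
Context (d : set V -> 'Hom(V, R^o)).
Context (hd : complementary_polyhedron ip U Phi d).

Let dP := levi_factor ip U Phi d P.

Lemma dual_proj_apply f x : dual_space ip U f -> W x ->
  dual_proj ip W f x = f x.
Proof.
move=> [u Uu uf] Wx; rewrite /dual_proj.
have fE : flat ip (sharp ip f) = f.
  by rewrite /sharp; case: xgetP => [z _ //|/(_ u)].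
by rewrite -[in RHS]fE /flat !lfunE /= [LHS]ip_sym [RHS]ip_sym ip_orth_proj.
Qed.

(** The chamber chosen in the definition of the Levi factor is the only one
    around the facet with the given projection, namely that of the lift; and the
    projection does not change the values of a functional on [W]. *)
Lemma levi_factor_lift v w x : W v -> regular ip PhiP v -> U w -> lifts v w ->
  W x -> dP (face ip W PhiP v) x = d (face ip U Phi w) x.
Proof.
move=> Wv rv Uw vw Wx.
have rw := lift_regular rv vw.
have wp := lift_specializes_base vw.
have hc : weyl_chamber ip U Phi (face ip U Phi w).
  by apply/weyl_chamberP => //; exists w.
rewrite /dP /levi_factor; set c := xget _ _.
suff -> : c = face ip U Phi w.
  by apply: dual_proj_apply => //; have [h _ _] := hd; exact: h.
rewrite /c; case: xgetP => [{}c _ [{}hc pc cE]|]; last first.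
  move=> /(_ (face ip U Phi w))[].
  by split=> //; [exact/facet_ge_face|exact: lift_chamber_image].
have [u [Uu ru cu]] := (weyl_chamberP ip Phi c hU).1 hc.
move: pc cE; rewrite cu => /(facet_ge_face ip hU hs Up Uu) up cE.
apply: face_eq; apply: lift_same_facet vw.
apply: same_facet_lift (orth_proj_lift up).
have : (orth_proj ip W @` face ip U Phi u) (orth_proj ip W u).
  by exists u => //; exact: face_refl.
by rewrite cE => -[_ /same_facetC].
Qed.

Lemma reflection_face a w : a \in Phi ->
  reflection ip a @` face ip U Phi w = face ip U Phi (reflection ip a w).
Proof.
move=> aP; have a0 := root_neq0 hPhi aP.
have Ur x : U x -> U (reflection ip a x).
  move=> Ux; apply: subspaceB => //; apply: subspaceZ => //.
  exact: (root_mem hPhi aP).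
have fr x y : same_facet ip Phi x y ->
    same_facet ip Phi (reflection ip a x) (reflection ip a y).
  move=> /same_facetP xy; apply/same_facetP => b bP.
  by rewrite -!ip_reflection xy// (root_reflection hPhi).
apply/seteqP; split=> [_ [x [Ux wx] <-]|x [Ux wx]].
  by split; [exact: Ur|exact: fr].
exists (reflection ip a x); last by rewrite reflectionK.
by split; [exact: Ur|rewrite -[w](reflectionK ip a0); exact: fr].
Qed.

(** For (A1), a common point [l] of two closed Levi chambers is, up to a
    positive factor, the difference of [p + s *: l] and [p], which are common
    points of the closures of the lifted chambers. For (A2), a reflection in
    [PhiP] fixes [p] and so lifts conjugate chambers to conjugate chambers. *)
Lemma levi_factor_polyhedron : complementary_polyhedron ip W PhiP dP.
Proof.
have hW := levi_subspace.
split.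
- move=> c _; exists (orth_proj ip W (sharp ip (d (xget set0
    [set c0 | [/\ weyl_chamber ip U Phi c0, facet_ge ip P c0 &
      orth_proj ip W @` c0 = c]])))) => //.
  exact: (orth_projP _).1.
- move=> c e l /(weyl_chamberP ip PhiP _ hW)[v [Wv rv ->]].
  move=> /(weyl_chamberP ip PhiP _ hW)[u [Wu ru ->]].
  move=> [/(vert_specializes hPhiP Wv)[Wl vl]].
  move=> /(vert_specializes hPhiP Wu)[_ ul].
  have [t t0 vv] := lift_exists v; have [r r0 uu] := lift_exists u.
  have [s s0 ll] := lift_exists l.
  have Uv : U (p + t *: v) by apply: subspaceD => //; apply: subspaceZ Wv.1.
  have Uu : U (p + r *: u) by apply: subspaceD => //; apply: subspaceZ Wu.1.
  have Ul : U (p + s *: l) by apply: subspaceD => //; apply: subspaceZ Wl.1.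
  rewrite (levi_factor_lift Wv rv Uv vv Wl) (levi_factor_lift Wu ru Uu uu Wl).
  have rv' := lift_regular rv vv; have ru' := lift_regular ru uu.
  have agree := polyhedron_agree hPhi hd Uv rv' Uu ru'.
  have := agree _ Ul (lift_specializes vv ll vl) (lift_specializes uu ll ul).
  have vp := lift_specializes_base vv; have up := lift_specializes_base uu.
  rewrite !linearD !linearZ /= (agree p Up vp up) => /addrI.
  by apply: mulfI; rewrite gt_eqF.
- move=> c e a /(weyl_chamberP ip PhiP _ hW)[v [Wv rv ->]].
  move=> /(weyl_chamberP ip PhiP _ hW)[u [Wu ru ->]] aP [pos _ uE].
  have aP' : a \in Phi by move: aP; rewrite levi_rootsP => /andP[].
  have [t t0 vv] := lift_exists v.
  have Uv : U (p + t *: v) by apply: subspaceD => //; apply: subspaceZ Wv.1.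
  have rv' := lift_regular rv vv; have rlift := lift_reflection aP vv.
  have : face ip W PhiP u (reflection ip a v).
    by rewrite uE; exists v => //; exact: face_refl.
  move=> [Wav uav].
  have rav : regular ip PhiP (reflection ip a v).
    move: uav => /same_facetP uav b bP.
    by rewrite -sgr_eq0 -uav// sgr_eq0 ru.
  have ra := lift_regular rav rlift.
  have Wa := levi_root_mem aP.
  have Uav : U (reflection ip a (p + t *: v)).
    apply: subspaceB => //; apply: subspaceZ => //.
    exact: (root_mem hPhi aP').
  rewrite (face_eq W uav) (levi_factor_lift Wv rv Uv vv Wa).
  rewrite (levi_factor_lift Wav rav Uav rlift Wa).
  have av : 0 < ip a (p + t *: v).
    rewrite -sgr_gt0 vv//; move: aP; rewrite levi_rootsP => /andP[_ ->].
    by rewrite sgr_gt0; apply: pos; exact: face_refl.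
  have [_ _ hA2] := hd; apply: hA2 => //.
  + by apply/weyl_chamberP => //; exists (p + t *: v).
  + by apply/weyl_chamberP => //; exists (reflection ip a (p + t *: v)).
  split; last by rewrite reflection_face.
    by move=> x [_ /same_facetP vx]; rewrite -sgr_gt0 -vx// sgr_gt0.
  move=> x [_ /same_facetP vx]; rewrite -sgr_lt0 -vx// sgr_lt0.
  by rewrite ip_root_reflection ?oppr_lt0// (root_neq0 hPhi).
Qed.

End Factor.
End Levi.

(** * Jordan-Hoelder facets *)

Section JordanHolder.
Context (R : realType) (V : vectType R) (ip : {dot V for idfun}).
Context (U : set V) (Phi : {fset V}) (hPhi : root_system ip U Phi).
Context (d : set V -> 'Hom(V, R^o)).
Context (hd : complementary_polyhedron ip U Phi d).
Context (hss : semistable ip U Phi d).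
Implicit Types (a p q v x y : V) (s : R).

Let hU : subspace U := root_space_subspace hPhi.
Let hs : sign_symmetric Phi := root_opp hPhi.

(** The point [x] is [p + s *: w], where [w] is the sum of the roots of the Levi
    system that are nonnegative at [q]; as [w] lies in the facet of [q], the
    points [x] and [p + s *: q] lie in the same facet, and the term of [d] at
    [p] vanishes by (J1). *)
Lemma levi_deg p q : U p -> J1 ip U Phi d (face ip U Phi p) ->
  let W := levi_space ip U (face ip U Phi p) in
  let PhiP := levi_roots ip U Phi (face ip U Phi p) in
  W q -> exists v x s, [/\ [/\ U v, regular ip Phi v & specializes ip Phi v x],
    U x, lifts ip Phi p q x, 0 < s &
    d (face ip U Phi v) x = s * deg ip W PhiP
      (levi_factor ip U Phi d (face ip U Phi p)) (face ip W PhiP q)].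
Proof.
move=> Up hJ W PhiP Wq.
have hPhiP : root_system ip W PhiP := levi_root_system hPhi Up.
have [v' [Wv rv' vq cE]] := chamber_ofP hPhiP Wq.
have [t t0 vv] := lift_exists ip Phi p v'.
have Uv : U (p + t *: v') by apply: subspaceD => //; apply: subspaceZ Wv.1.
have rv : regular ip Phi (p + t *: v') := lift_regular hPhi Up rv' vv.
pose w := nonneg_root_sum ip PhiP q.
have Ww : W w := nonneg_root_sum_mem hPhiP q.
have qw : same_facet ip PhiP q w := nonneg_root_sum_face hPhiP q.
have [s s0 ww] := lift_exists ip Phi p w.
have vx : specializes ip Phi (p + t *: v') (p + s *: w).
  apply: (lift_specializes hPhi Up vv ww).
  exact: specializes_trans vq (same_facet_specializes qw).
exists (p + t *: v'), (p + s *: w), s; split=> //.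
- by apply: subspaceD => //; apply: subspaceZ Ww.1.
- exact: (same_facet_lift hPhi Up (same_facetC qw) ww).
rewrite (deg_nonneg_root_sum hPhiP) ?cE//.
rewrite (levi_factor_lift hPhi Up hd Wv rv' Uv vv Ww) linearD linearZ /=.
have vp := lift_specializes_base vv.
by rewrite ((J1P hPhi hd hss Uv rv Up vp).1 hJ) add0r.
Qed.

Lemma minimal_J1_jordan_holder P :
  minimal_J1_facet ip U Phi d P -> jordan_holder_facet ip U Phi d P.
Proof.
move=> [[p Up ->] hJ hmin]; split=> //; first by exists p.
have hPhiP := levi_root_system hPhi Up.
split; first exact: levi_factor_polyhedron.
move=> _ [q Wq ->] Q0.
have [v [x [s [[Uv rv vx] Ux qx s0 dx]]]] := levi_deg Up hJ Wq.
have : d (face ip U Phi v) x <= 0 by exact: (semistable_le0 hPhi hd hss).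
rewrite dx pmulr_rle0// le_eqVlt => /orP[/eqP deg0|//].
have Jx : J1 ip U Phi d (face ip U Phi x).
  by apply/(J1P hPhi hd hss Uv rv Ux vx); rewrite dx deg0 mulr0.
have xp := lift_specializes_base qx.
have Exp : face ip U Phi x = face ip U Phi p.
  by apply: hmin => //; [exists x|exact/facet_ge_face].
case: Q0; suff -> : q = 0 by exact: (face0 hPhiP).
apply: (root_span_eq0 hPhiP Wq) => a; rewrite (levi_rootsP hPhi Up).
move=> /andP[aP ap].
have : face ip U Phi p x by rewrite -Exp; exact: face_refl.
move=> [_ /same_facetP/(_ a aP)]; rewrite qx// ap (eqP ap) sgr0.
by move=> /esym/eqP; rewrite sgr_eq0 => /eqP.
Qed.

Lemma jordan_holder_minimal_J1 P :
  jordan_holder_facet ip U Phi d P -> minimal_J1_facet ip U Phi d P.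
Proof.
move=> [[p Up ->] hJ [_ hst]]; split=> //; first by exists p.
move=> _ [y Uy ->] Jy /(facet_ge_face ip hU hs Up Uy) yp.
have hPhiP := levi_root_system hPhi Up.
have qy := orth_proj_lift hPhi Up yp.
have Wq := (orth_projP hPhi Up y).1.
set q := orth_proj _ _ y in qy Wq.
have [q0|q0] := pselect (q = 0).
  apply: face_eq; apply: (same_facet_specializesP hs yp) => a aP ap.
  rewrite -sgr_ge0 qy//; case: ifPn => [_|]; last by rewrite sgr_ge0.
  by rewrite q0 ip0r sgr0.
have [v [x [s [[Uv rv vx] Ux qx s0 dx]]]] := levi_deg Up hJ Wq.
have : d (face ip U Phi v) x = 0.
  apply/(J1P hPhi hd hss Uv rv Ux vx).
  by rewrite (face_eq U (lift_same_facet qx qy)).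
rewrite dx => /eqP; rewrite mulf_eq0 gt_eqF//= => /eqP deg0.
have := hst _ (ex_intro2 _ _ q Wq erefl).
rewrite deg0 ltxx; case=> // F0.
apply: q0; have : face ip (levi_space ip U (face ip U Phi p))
  (levi_roots ip U Phi (face ip U Phi p)) q q by exact: face_refl.
by rewrite /face F0.
Qed.

(** Passing to a facet with [face p] in its closure never decreases the number
    of root hyperplanes avoided, and leaves it unchanged only if the facet stays
    the same; so a facet avoiding the most hyperplanes is minimal. The facet
    [{0}] satisfies (J1). *)
Lemma minimal_J1_exists : exists P, minimal_J1_facet ip U Phi d P.
Proof.
pose supp p := [fset a in Phi | ip a p != 0]%fset.
pose good n := `[< exists p, [/\ U p, J1 ip U Phi d (face ip U Phi p) &
  #|` supp p| = n] >].
have good0 : exists n, good n.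
  exists #|` supp 0|; apply/asboolP; exists 0; split=> //; first exact: hU.1.
  have U0 := hU.1.
  have [v [Uv rv v0]] := chamber_exists hPhi U0.
  by apply/(J1P hPhi hd hss Uv rv U0 v0); rewrite linear0.
have goodb n : good n -> (n <= #|` Phi|)%N.
  move=> /asboolP[p [_ _ <-]]; apply: fsubset_leq_card.
  by apply/fsubsetP => a; rewrite !inE /= => /andP[].
case: (ex_maxnP good0 goodb) => n /asboolP[p [Up Jp pn]] nmax.
exists (face ip U Phi p); split=> //; first by exists p.
move=> _ [y Uy ->] Jy /(facet_ge_face ip hU hs Up Uy) yp.
have sub : (supp p `<=` supp y)%fset.
  apply/fsubsetP => a; rewrite !inE /= => /andP[aP ap]; rewrite aP /=.
  by apply: contra_neq ap; exact: (specializes_eq0 hs yp aP).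
have /eqP suppE : supp p == supp y.
  rewrite eqEfcard sub pn; apply: nmax; apply/asboolP.
  by exists y.
apply: face_eq; apply: (same_facet_specializesP hs yp) => a aP.
rewrite le_eqVlt => /orP[/eqP/esym ap|ap].
  have : a \notin supp y by rewrite -suppE !inE /= aP ap eqxx.
  by rewrite !inE /= aP negbK => /eqP ->.
exact/ltW/(specializes_lt hs yp aP).
Qed.

End JordanHolder.

Theorem theorem2p5p6 (R : realType) (V : vectType R)
  (ip : {dot V for idfun}) (Phi : {fset V}) (d : set V -> 'Hom(V, R^o))
  (hPhi : root_system ip setT Phi)
  (hd : complementary_polyhedron ip setT Phi d)
  (hss : semistable ip setT Phi d) :
  (forall P : set V, facet ip setT Phi P ->
     (jordan_holder_facet ip setT Phi d P <->
      minimal_J1_facet ip setT Phi d P)) /\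
  (exists P : set V, jordan_holder_facet ip setT Phi d P).
Proof.
split=> [P _|].
  split; first exact: jordan_holder_minimal_J1.
  exact: minimal_J1_jordan_holder.
have [P hP] := minimal_J1_exists hPhi hd hss.
by exists P; exact: minimal_J1_jordan_holder.
Qed.
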